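(* There is a function $f$, computable in polynomial time with $f(I)$ bounded by a polynomial in $|I|$ for every X3C instance $I$, such that every X3C instance $I$ can be reduced in polynomial time to a Possible Winner instance for any scoring vector $(\alpha_1,\dots,\alpha_m)$ of size $m=f(I)+2$ satisfying $\alpha_1>\alpha_2=\alpha_{m-1}>\alpha_m=0$ and $\alpha_1<2\alpha_2$; i.e., one can construct in polynomial time a set of $m$ candidates, a list of partial votes and a distinguished candidate $c$ such that $c$ is a possible winner with respect to this vector iff $I$ is a yes-instance.
   Context: A scoring vector is $(\alpha_1,\dots,\alpha_m)$ with integers $\alpha_1\ge\dots\ge\alpha_m$; the candidate at position $j$ of a linear order gets $\alpha_j$ points. A partial vote is a transitive antisymmetric relation on the candidates; $c$ is a possible winner if some extension of all partial votes into linear orders gives $c$ maximum total score (the result also holds for the unique-winner variant). Exact Cover by 3-Sets (X3C): given a set $E$ and a family $\mathcal S$ of 3-element subsets of $E$, decide whether some subfamily covers each element of $E$ exactly once. *)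

(* Defs.v *)
From Stdlib Require Import BinNums.
From HB Require Import structures.
From mathcomp Require Import all_boot all_order all_algebra.

Set Implicit Arguments.
Unset Strict Implicit.
Unset Printing Implicit Defensive.

Import Order.TTheory GRing.Theory Num.Theory.

Local Open Scope ring_scope.

(** * Polynomial time: deterministic multitape Turing machines *)

(* [None] is the blank symbol. *)
Definition cell := option bool.

(* Two-way infinite tape [(l, r)]: [l] lists the cells to the left of the head,
   nearest first; [r] lists the scanned cell and the cells to its right. All
   the cells beyond the ends of [l] and [r] are blank. *)
Definition tape : Type := (seq cell * seq cell)%type.

Inductive move := MoveLeft | Stay | MoveRight.

Definition read (t : tape) : cell := head None t.2.

Definition write (b : cell) (t : tape) : tape := (t.1, b :: behead t.2).

Definition shift (d : move) (t : tape) : tape :=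
  match d with
  | MoveLeft => (behead t.1, head None t.1 :: t.2)
  | Stay => t
  | MoveRight => (head None t.2 :: t.1, behead t.2)
  end.

(* The tapes are numbered by ['I_ntapes.+1]; tape [0] carries the input and,
   when the machine stops, the output. *)
Record tm := TM {
  ntapes : nat;
  state : finType;
  start : state;
  final : pred state;
  delta : state -> {ffun 'I_ntapes.+1 -> cell} ->
          state * {ffun 'I_ntapes.+1 -> cell * move}
}.

Definition config (M : tm) : Type :=
  (state M * {ffun 'I_(ntapes M).+1 -> tape})%type.

Definition init (M : tm) (w : seq bool) : config M :=
  (start M, [ffun i => ([::], if i == ord0 then map Some w else [::])]).

(* Configurations in a final state are fixed points of [step]. *)
Definition step (M : tm) (c : config M) : config M :=
  if final c.1 then c else
  let: (q, act) := delta c.1 [ffun i => read (c.2 i)] in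
  (q, [ffun i => shift (act i).2 (write (act i).1 (c.2 i))]).

Fixpoint bits_until_blank (r : seq cell) : seq bool :=
  if r is Some b :: r' then b :: bits_until_blank r' else [::].

Definition output (M : tm) (c : config M) : seq bool :=
  bits_until_blank (c.2 ord0).2.

(* [w] is the input, [u] the output, and [n] bounds the number of steps. *)
Definition computes_within (M : tm) (n : nat) (w u : seq bool) : Prop :=
  let c := iter n (@step M) (init M w) in final c.1 /\ output c = u.

Definition poly_time (A B : Type) (encA : A -> seq bool) (encB : B -> seq bool)
    (f : A -> B) : Prop :=
  exists (M : tm) (p : {poly nat}),
    forall a : A, computes_within M p.[size (encA a)] (encA a) (encB (f a)).

(** * Encodings as bit strings *)

(* Every encoding below is prefix-free, so that concatenation encodes pairs. *)
Definition enc_unary (n : nat) : seq bool := rcons (nseq n true) false.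

Definition enc_seq (A : Type) (enc : A -> seq bool) (s : seq A) : seq bool :=
  rcons (flatten [seq true :: enc x | x <- s]) false.

(* Binary digits, least significant first. *)
Fixpoint pos_bits (p : positive) : seq bool :=
  match p with
  | xH => [:: true]
  | xO q => false :: pos_bits q
  | xI q => true :: pos_bits q
  end.

Definition bits (n : nat) : seq bool :=
  if bin_of_nat n is Npos p then pos_bits p else [::].

Definition enc_nat (n : nat) : seq bool := enc_seq (fun b => [:: b]) (bits n).

Definition enc_int (z : int) : seq bool := (z < 0) :: enc_nat `|z|%N.

Definition enc_pair (A B : Type) (encA : A -> seq bool) (encB : B -> seq bool)
    (x : A * B) : seq bool := encA x.1 ++ encB x.2.

(** * Exact Cover by 3-Sets *)

(* The ground set is ['I_x3c_n]; the family is listed without repetition, in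
   an arbitrary order. *)
Record x3c := X3C {
  x3c_n : nat;
  x3c_sets : seq {set 'I_x3c_n};
  x3c_uniq : uniq x3c_sets;
  x3c_card3 : all (fun A : {set 'I_x3c_n} => #|A| == 3%N) x3c_sets
}.

Definition has_exact_cover (I : x3c) : Prop :=
  exists T : {set {set 'I_(x3c_n I)}},
    {subset T <= x3c_sets I} /\
    forall e : 'I_(x3c_n I), #|[set A in T | e \in A]| = 1%N.

(* Ground set in unary, then one characteristic vector for each set. *)
Definition enc_x3c (I : x3c) : seq bool :=
  enc_unary (x3c_n I) ++
  enc_seq (fun A : {set 'I_(x3c_n I)} => [seq e \in A | e <- enum 'I_(x3c_n I)])
    (x3c_sets I).

(** * Possible winners for a scoring vector *)

(* A relation on the candidates is the set of its pairs; [(a, b) \in v] means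
   that [v] ranks [a] above [b] (or [a = b]). *)
Definition vote (m : nat) : finType := {set 'I_m * 'I_m}.

Definition prefers (m : nat) (v : vote m) : rel 'I_m := fun a b => (a, b) \in v.

Definition partial_vote (m : nat) (v : vote m) : Prop :=
  transitive (prefers v) /\ antisymmetric (prefers v).

(* [total] includes reflexivity, which [partial_vote] leaves open. *)
Definition linear_order (m : nat) (v : vote m) : Prop :=
  [/\ transitive (prefers v), antisymmetric (prefers v) & total (prefers v)].

Record pw_instance := PWInstance {
  pw_m : nat;
  pw_votes : seq (vote pw_m);
  pw_dist : 'I_pw_m;
  pw_partial : forall v, v \in pw_votes -> partial_vote v
}.

Definition enc_vote (m : nat) (v : vote m) : seq bool :=
  [seq prefers v a b | a <- enum 'I_m, b <- enum 'I_m].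

Definition enc_pw (P : pw_instance) : seq bool :=
  enc_unary (pw_m P) ++ enc_unary (pw_dist P) ++
  enc_seq (@enc_vote (pw_m P)) (pw_votes P).

(* Positions are counted from [0]. *)
Definition position (m : nat) (v : vote m) (a : 'I_m) : nat :=
  #|[set b | (b != a) && prefers v b a]|.

Definition is_scoring_vector (alpha : seq int) : bool :=
  sorted (fun x y => y <= x) alpha.

Definition score (alpha : seq int) (m k : nat) (L : 'I_k -> vote m)
    (a : 'I_m) : int :=
  \sum_(i < k) alpha`_(position (L i) a).

(* Co-winner version; meaningful when [size alpha = pw_m P]. *)
Definition possible_winner (alpha : seq int) (P : pw_instance) : Prop :=
  exists L : 'I_(size (pw_votes P)) -> vote (pw_m P),
    (forall i, linear_order (L i) /\ tnth (in_tuple (pw_votes P)) i \subset L i) /\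
    (forall a, score alpha L a <= score alpha L (pw_dist P)).

(* Main.v *)
Require Import Defs.
From HB Require Import structures.
From mathcomp Require Import all_boot all_order all_algebra.
From mathcomp Require Import zify.

(* Relative to the common middle value [B], a first place is worth [d] and a last
   place costs [B], where [0 < d < B]. Every vote of the construction has a set
   [X] of maximal and a set [Y] of minimal candidates, and it can be completed
   with any first candidate in [X] and any other last candidate in [Y]. The
   distinguished candidate is first exactly once and never last, so that it wins
   iff every candidate that is first [F] times and last [G] times has
   [d F - B G <= d]. Only cases that do not depend on [d / B] occur: [F <= 1] for
   a candidate that is never last, and [F <= G + 1].

   Each set of the instance has one candidate per element and a prefix
   candidate, forming a row; the vote of a candidate of the row is led by the
   candidate or its predecessor and ended by the candidate or a sink. The prefix
   has instead of a predecessor a pool of [n / 3] candidates, each of which can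
   be first once. If the pool does not lead the vote of the prefix, then, since a
   candidate leading its own vote is never last and can be first only once, all
   the candidates of the row lead their own votes and no other. There is also a
   vote for each element, which must be led by the candidate of this element in
   some row whose set contains it. Hence at most [n / 3] sets cover all the
   elements, and conversely.

   The instance does not depend on the scoring vector. Its candidates are the
   positions in the encoding of the X3C instance, and two more; there is one vote
   for each candidate. A Turing machine prints it with three nested loops over
   the positions, comparing them by the distances between heads. *)

Set Implicit Arguments.
Unset Strict Implicit.
Unset Printing Implicit Defensive.

Import Order.TTheory GRing.Theory Num.Theory.

Local Open Scope ring_scope.

(** * Structured programs for Turing machines *)

Definition cellat (t : tape) (i : int) : cell :=
  match i with Posz j => nth None t.2 j | Negz j => nth None t.1 j end.

Definition mvz (d : move) : int :=
  match d with MoveLeft => -1 | Stay => 0 | MoveRight => 1 end.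

Lemma cellat_step (b : cell) (d : move) (t : tape) (i : int) :
  cellat (shift d (write b t)) i = if i + mvz d == 0 then b else cellat t (i + mvz d).
Proof.
case: t => l r; case: d; rewrite /mvz.
- case: i => [[|[|j]]|j].
  + by case: l.
  + by [].
  + have -> : Posz j.+2 - 1 = Posz j.+1 by lia.
    by rewrite /= nth_behead.
  + have -> : Negz j - 1 = Negz j.+1 by lia.
    by rewrite /= nth_behead.
- by rewrite addr0; case: i => [[|j]|j] //=; rewrite nth_behead.
- case: i => [j|[|j]].
  + have -> : Posz j + 1 = Posz j.+1 by lia.
    by rewrite /= nth_behead.
  + by [].
  + by have -> : Negz j.+1 + 1 = Negz j by lia.
Qed.

Section Programs.

Variable k : nat.
Local Notation tix := 'I_k.+1.
Local Notation cells := {ffun tix -> cell}.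

(** All data live on the tapes; the control only records the place in the program. The action of
    [Do] depends on all the scanned cells at once. *)
Inductive prog :=
| Do of cells -> tix -> cell * move
| Seq of prog & prog
| If of cells -> bool & prog & prog
| While of cells -> bool & prog.

Definition keep (r : cells) (i : tix) : cell * move := (r i, Stay).

Fixpoint pstate (p : prog) : finType :=
  match p with
  | Do _ => unit
  | Seq p q => (pstate p + pstate q)%type
  | If _ p q => option (pstate p + pstate q)
  | While _ p => option (pstate p)
  end.

Fixpoint entry (p : prog) : pstate p :=
  match p with
  | Do _ => tt
  | Seq p q => inl (entry p)
  | If _ _ _ => None
  | While _ _ => None
  end.

(** A successor [None] means that the program ends with this action. A test takes a step of its own,
    in which [keep] writes back what was read. *)
Fixpoint ptrans (p : prog) : pstate p -> cells ->
    option (pstate p) * (tix -> cell * move) :=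
  match p with
  | Do a => fun _ r => (None, a r)
  | Seq p q => fun s r =>
      match s with
      | inl s1 => let: (o, a) := ptrans s1 r in
                  (Some (if o is Some s2 then inl s2 else inr (entry q)), a)
      | inr s1 => let: (o, a) := ptrans s1 r in (omap inr o, a)
      end
  | If b p q => fun s r =>
      match s with
      | None => (Some (Some (if b r then inl (entry p) else inr (entry q))), keep r)
      | Some (inl s1) => let: (o, a) := ptrans s1 r in (omap (Some \o inl) o, a)
      | Some (inr s1) => let: (o, a) := ptrans s1 r in (omap (Some \o inr) o, a)
      end
  | While b p => fun s r =>
      match s with
      | None => (if b r then Some (Some (entry p)) else None, keep r)
      | Some s1 => let: (o, a) := ptrans s1 r in (Some o, a)
      end
  end.

Definition compile (p : prog) : tm :=
  @TM k (option (pstate p)) (Some (entry p)) (fun s => s == None)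
    (fun s r => if s is Some s1 then
                  let: (o, a) := ptrans s1 r in (o, [ffun i => a i])
                else (None, [ffun i => keep r i])).

Definition tapes := {ffun tix -> tape}.
Definition treads (t : tapes) : cells := [ffun i => read (t i)].
Definition tact (a : tix -> cell * move) (t : tapes) : tapes :=
  [ffun i => shift (a i).2 (write (a i).1 (t i))].

Inductive reach (p : prog) : pstate p -> tapes -> nat -> tapes -> Prop :=
| reach_exit s t a : ptrans s (treads t) = (None, a) -> reach s t 1 (tact a t)
| reach_step s s' t a n t' : ptrans s (treads t) = (Some s', a) ->
    reach s' (tact a t) n t' -> reach s t n.+1 t'.

Lemma reach_iter p (s : pstate p) t n t' : reach s t n t' ->
  iter n (@step (compile p)) (Some s, t) = (None, t').
Proof.
have stepE (s0 : pstate p) t0 o a : ptrans s0 (treads t0) = (o, a) ->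
    @step (compile p) (Some s0, t0) = (o, tact a t0).
  move=> H; rewrite /step /= -/(treads t0) H /=; congr pair.
  by apply/ffunP => i; rewrite !ffunE.
elim=> {s t n t'} [s t a /stepE H|s s' t a n t' /stepE H _ IH].
  by rewrite /= H.
by rewrite iterSr H.
Qed.

Lemma reach_seqr p q (s : pstate q) t n t' : reach s t n t' ->
  @reach (Seq p q) (inr s) t n t'.
Proof.
elim=> {s t n t'} [s t a H|s s' t a n t' H _ IH].
  by apply: reach_exit; rewrite /= H.
by apply: (@reach_step (Seq p q) _ (inr s') _ a) => //=; rewrite H.
Qed.

Lemma reach_seq p q (s : pstate p) t n t1 n' t' : reach s t n t1 ->
  reach (entry q) t1 n' t' -> @reach (Seq p q) (inl s) t (n + n') t'.
Proof.
move=> H; elim: H => {s t n t1} [s t a H|s s' t a n t1 H _ IH] Hq.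
  rewrite add1n; apply: (@reach_step (Seq p q) _ (inr (entry q)) _ a).
    by rewrite /= H.
  exact: reach_seqr.
rewrite addSn; apply: (@reach_step (Seq p q) _ (inl s') _ a) => /=; first by rewrite H.
exact: IH.
Qed.

Lemma reach_ifl b p q (s : pstate p) t n t' : reach s t n t' ->
  @reach (If b p q) (Some (inl s)) t n t'.
Proof.
elim=> {s t n t'} [s t a H|s s' t a n t' H _ IH].
  by apply: reach_exit; rewrite /= H.
by apply: (@reach_step (If b p q) _ (Some (inl s')) _ a) => //=; rewrite H.
Qed.

Lemma reach_ifr b p q (s : pstate q) t n t' : reach s t n t' ->
  @reach (If b p q) (Some (inr s)) t n t'.
Proof.
elim=> {s t n t'} [s t a H|s s' t a n t' H _ IH].
  by apply: reach_exit; rewrite /= H.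
by apply: (@reach_step (If b p q) _ (Some (inr s')) _ a) => //=; rewrite H.
Qed.

Lemma reach_while b p (s : pstate p) t n t1 n' t' : reach s t n t1 ->
  @reach (While b p) None t1 n' t' -> @reach (While b p) (Some s) t (n + n') t'.
Proof.
move=> H; elim: H => {s t n t1} [s t a H|s s' t a n t1 H _ IH] Hq.
  by rewrite add1n; apply: (@reach_step (While b p) _ None _ a) => //=; rewrite H.
rewrite addSn; apply: (@reach_step (While b p) _ (Some s') _ a) => /=; first by rewrite H.
exact: IH.
Qed.

(* The abstract state gives each tape as its absolute contents and the absolute
   position of its head. *)
Definition atapes := tix -> (int -> cell) * int.

Definition areads (s : atapes) : cells := [ffun i => (s i).1 (s i).2].

Definition aact (a : tix -> cell * move) (s : atapes) : atapes := fun i =>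
  ((fun j => if j == (s i).2 then (a i).1 else (s i).1 j), (s i).2 + mvz (a i).2).

Definition represents (t : tapes) (s : atapes) : Prop :=
  forall i j, cellat (t i) j = (s i).1 ((s i).2 + j).

Lemma represents_reads t s : represents t s -> treads t = areads s.
Proof.
move=> H; apply/ffunP => i; rewrite !ffunE.
by have := H i 0; rewrite addr0 => <-; rewrite /read /=; case: (t i).2.
Qed.

Lemma represents_act a t s : represents t s -> represents (tact a t) (aact a s).
Proof.
move=> H i j; rewrite ffunE cellat_step /= H.
have -> : ((s i).2 + mvz (a i).2 + j == (s i).2) = (j + mvz (a i).2 == 0).
  by apply/eqP/eqP; lia.
by case: eqP => // _; congr (_ _); lia.
Qed.

(** Writing back a blank may lengthen the stored lists, so the tape can change as a pair of lists,
    but not the contents that it represents. *)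
Lemma represents_keep t s : represents t s ->
  represents (tact (keep (treads t)) t) s.
Proof.
move=> H i j; rewrite ffunE cellat_step /= H addr0; case: eqP => // ->.
by rewrite addr0 (represents_reads H) ffunE.
Qed.

(** Big-step semantics with the exact number of steps: a test costs one step, and passing from one
    program to the next is free. *)
Inductive exec : prog -> atapes -> nat -> atapes -> Prop :=
| exec_do a s : exec (Do a) s 1 (aact (a (areads s)) s)
| exec_seq p q s n s1 n' s' : exec p s n s1 -> exec q s1 n' s' ->
    exec (Seq p q) s (n + n') s'
| exec_ifT (b : cells -> bool) p q s n s' : b (areads s) -> exec p s n s' ->
    exec (If b p q) s n.+1 s'
| exec_ifF (b : cells -> bool) p q s n s' : ~~ b (areads s) -> exec q s n s' ->
    exec (If b p q) s n.+1 s'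
| exec_whileT (b : cells -> bool) p s n s1 n' s' : b (areads s) -> exec p s n s1 ->
    exec (While b p) s1 n' s' -> exec (While b p) s (n + n').+1 s'
| exec_whileF (b : cells -> bool) p s : ~~ b (areads s) -> exec (While b p) s 1 s.

Lemma exec_reach p s n s' : exec p s n s' -> forall t, represents t s ->
  exists2 t', reach (entry p) t n t' & represents t' s'.
Proof.
elim=> {p s n s'}.
- move=> a s t H; exists (tact (a (areads s)) t); last exact: represents_act.
  by rewrite -(represents_reads H); apply: reach_exit.
- move=> p q s n s1 n' s' _ IH1 _ IH2 t /IH1[t1 H1 /IH2[t2 H2 H]].
  by exists t2 => //; apply: reach_seq H2.
- move=> b p q s n s' Hb _ IH t Ht; have [t' H H'] := IH _ (represents_keep Ht).
  exists t' => //; apply: reach_step (reach_ifl _ _ H).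
  by rewrite /= (represents_reads Ht) Hb.
- move=> b p q s n s' Hb _ IH t Ht; have [t' H H'] := IH _ (represents_keep Ht).
  exists t' => //; apply: reach_step (reach_ifr _ _ H).
  by rewrite /= (represents_reads Ht) (negbTE Hb).
- move=> b p s n s1 n' s' Hb _ IH1 _ IH2 t Ht.
  have [t1 H1 /IH2[t2 H2 H]] := IH1 _ (represents_keep Ht).
  exists t2 => //; apply: reach_step (reach_while H1 H2).
  by rewrite /= (represents_reads Ht) Hb.
- move=> b p s Hb t Ht; exists (tact (keep (treads t)) t); last exact: represents_keep.
  by apply: reach_exit; rewrite /= {1}(represents_reads Ht) (negbTE Hb).
Qed.

(** * Time-bounded Hoare triples *)

Definition runs (p : prog) (s : atapes) (n : nat) (Q : atapes -> Prop) : Prop :=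
  exists n' s', [/\ (n' <= n)%N, exec p s n' s' & Q s'].

Lemma runs_do a s (Q : atapes -> Prop) :
  Q (aact (a (areads s)) s) -> runs (Do a) s 1 Q.
Proof. by move=> H; exists 1%N, (aact (a (areads s)) s); split => //; constructor. Qed.

(** The postcondition of [p] is that [q] runs as required, so that correctness proofs follow the
    program from left to right. *)
Lemma runs_seq p q s n1 n2 Q : runs p s n1 (fun s1 => runs q s1 n2 Q) ->
  runs (Seq p q) s (n1 + n2) Q.
Proof.
case=> n [s1 [Hn H1 [n' [s2 [Hn' H2 HQ]]]]]; exists (n + n')%N, s2.
by split => //; [exact: leq_add | exact: exec_seq H2].
Qed.

Lemma runs_if (b : cells -> bool) p q s n Q :
  (b (areads s) -> runs p s n Q) -> (~~ b (areads s) -> runs q s n Q) ->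
  runs (If b p q) s n.+1 Q.
Proof.
move=> Hp Hq; have [Hb|Hb] := boolP (b (areads s)).
  by have [n' [s' [Hn H HQ]]] := Hp Hb; exists n'.+1, s'; split => //; constructor.
have [n' [s' [Hn H HQ]]] := Hq Hb; exists n'.+1, s'; split => //.
exact: exec_ifF.
Qed.

(** The number [K] of iterations is known beforehand and the invariant is indexed by the iteration,
    which gives termination and time together: one test per iteration and one more to leave. *)
Lemma runs_while (b : cells -> bool) p K n (Inv : nat -> atapes -> Prop) s :
  (forall i s, (i < K)%N -> Inv i s -> b (areads s) /\ runs p s n (Inv i.+1)) ->
  (forall s, Inv K s -> ~~ b (areads s)) ->
  Inv 0%N s -> runs (While b p) s (K * n.+1).+1 (Inv K).
Proof.
move=> Hstep Hend.
suff H j : forall i s, (i + j = K)%N -> Inv i s ->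
    runs (While b p) s (j * n.+1).+1 (Inv K) by apply: H.
elim: j => [|j IH] i s' Hij Hi.
  rewrite addn0 in Hij; subst i; exists 1%N, s'; split => //.
  by apply: exec_whileF; apply: Hend.
have [|Hb [n1 [s1 [Hn1 H1 Q1]]]] := Hstep i s' _ Hi; first lia.
have [|n2 [s2 [Hn2 H2 Q2]]] := IH i.+1 s1 _ Q1; first lia.
exists (n1 + n2).+1, s2; split => //; first lia.
exact: exec_whileT H2.
Qed.

Lemma runs_weaken p s n n' (Q Q' : atapes -> Prop) : (n <= n')%N ->
  (forall s, Q s -> Q' s) -> runs p s n Q -> runs p s n' Q'.
Proof.
move=> Hn HQ [n1 [s1 [H1 H2 H3]]]; exists n1, s1; split => //; last exact: HQ.
exact: leq_trans Hn.
Qed.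

Definition input_content (w : seq bool) (j : int) : cell :=
  if j is Posz i then nth None (map Some w) i else None.

Definition ainit (w : seq bool) : atapes :=
  fun i => (if i == ord0 then input_content w else fun=> None, 0).

(* The output starts at the final head position of tape [0]. *)
Definition shows (u : seq bool) (s : atapes) : Prop :=
  forall j : nat, (s ord0).1 ((s ord0).2 + j%:Z) = nth None (map Some u) j.

Lemma runs_computes p w u n : runs p (ainit w) n (shows u) ->
  computes_within (compile p) n w u.
Proof.
case=> n' [s' [Hn H Q]].
have Hinit : represents [ffun i => ([::], if i == ord0 then map Some w else [::])] (ainit w).
  move=> i j; rewrite ffunE /= add0r; case: (i == ord0); case: j => j //=; by rewrite nth_nil.
have [t' /reach_iter H1 H2] := exec_reach H Hinit.
(* The machine may stop before the allotted [n] steps; the remaining ones leave a final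
   configuration unchanged. *)
have fixed m : iter m (@step (compile p)) (None, t') = (None, t').
  by elim: m => //= m ->.
rewrite /computes_within -(subnK Hn) iterD /init H1 fixed /=; split=> //.
rewrite /output /=.
have {}Q j : nth None (t' ord0).2 j = nth None (map Some u) j.
  by have := H2 ord0 (Posz j) => /= ->; apply: Q.
elim: u (t' ord0).2 Q => [|b u IH] [|x r] Q //=.
- by have := Q 0%N => /= ->.
- by have := Q 0%N.
- by have := Q 0%N => /= ->; rewrite IH // => j; have := Q j.+1.
Qed.

Lemma aact_keep (i : tix) (a : tix -> cell * move) s :
  a i = keep (areads s) i ->
  (forall j, (aact a s i).1 j = (s i).1 j) /\ (aact a s i).2 = (s i).2.
Proof.
rewrite /aact => ->; rewrite /keep /= addr0; split=> // j.
by case: eqP => // ->; rewrite ffunE.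
Qed.

(** * Basic programs: moving heads and printing bits *)

Definition moves (v : tix -> move) : prog := Do (fun r i => (r i, v i)).

(** Contents are compared pointwise because writing back the scanned cell yields a function that is
    only extensionally the old one. *)
Definition moved (v : tix -> move) (n : nat) (s s' : atapes) : Prop :=
  forall i, (forall j, (s' i).1 j = (s i).1 j) /\ (s' i).2 = (s i).2 + mvz (v i) * n%:Z.

Lemma moved0 v s : moved v 0 s s.
Proof. by move=> i; rewrite mulr0 addr0. Qed.

Lemma moved_act v n s s' : moved v n s s' ->
  moved v n.+1 s (aact (fun i => (areads s' i, v i)) s').
Proof.
move=> H i /=; have [H1 H2] := H i; split=> [j|]; last by rewrite H2; lia.
by case: eqP => [->|_]; rewrite ?ffunE H1.
Qed.

Lemma runs_moves v s (Q : atapes -> Prop) :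
  (forall s', moved v 1 s s' -> Q s') -> runs (moves v) s 1 Q.
Proof. by move=> H; apply: runs_do; apply: H; apply: moved_act; apply: moved0. Qed.

Definition nonblank (l : tix) (r : cells) : bool := r l != None.

Definition sweep (l : tix) (v : tix -> move) : prog := While (nonblank l) (moves v).

Lemma runs_sweep l v K s (Q : atapes -> Prop) :
  (forall i, (i < K)%N -> (s l).1 ((s l).2 + mvz (v l) * i%:Z) <> None) ->
  (s l).1 ((s l).2 + mvz (v l) * K%:Z) = None ->
  (forall s', moved v K s s' -> Q s') ->
  runs (sweep l v) s (K * 2).+1 Q.
Proof.
move=> Hlt HK HQ; apply: (runs_weaken (leqnn _) HQ).
apply: (runs_while (Inv := fun i s' => moved v i s s')) => [i s' Hi H|s' H|].
- split; last by apply: runs_do; exact: moved_act.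
  by rewrite /nonblank ffunE; have [-> ->] := H l; apply/eqP; apply: Hlt.
- by rewrite /nonblank ffunE; have [-> ->] := H l; rewrite HK.
- exact: moved0.
Qed.

Definition writes (b : cells -> bool) : prog :=
  Do (fun r i => if i == ord0 then (Some (b r), MoveRight) else keep r i).

Definition only (l : tix) (d : move) (i : tix) : move := if i == l then d else Stay.

(** The blank before [base] is where the leftward sweep of [finish] stops. *)
Definition written (base : int) (u : seq bool) (s : atapes) : Prop :=
  [/\ (s ord0).2 = base + (size u)%:Z, (s ord0).1 (base - 1) = None &
      forall j : nat, (s ord0).1 (base + j%:Z) = nth None (map Some u) j].

Definition frame_eq (s s' : atapes) : Prop :=
  forall i, i != ord0 -> (forall j, (s' i).1 j = (s i).1 j) /\ (s' i).2 = (s i).2.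

Lemma runs_writes b base u s (Q : atapes -> Prop) : written base u s ->
  (forall s', written base (rcons u (b (areads s))) s' -> frame_eq s s' -> Q s') ->
  runs (writes b) s 1 Q.
Proof.
move=> [H1 H2 H3] HQ; apply: runs_do; apply: HQ.
  split; rewrite /aact /=; first by rewrite H1 size_rcons; lia.
    by case: eqP; [rewrite H1; lia|].
  move=> j; rewrite H1 H3 map_rcons nth_rcons size_map.
  case: eqP => [E|E].
    have -> : j = size u by lia.
    by rewrite ltnn eqxx.
  case: ltnP => // Hj; case: eqP => [Ej|_]; first by case: E; rewrite Ej.
  by rewrite nth_default ?size_map.
move=> i Hi; rewrite /aact (negbTE Hi) /= addr0; split=> // j.
by case: eqP => [->|//]; rewrite ffunE.
Qed.

(** The output of a machine is read from the final head position, so the head has to return to the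
    first printed bit. *)
Definition finish : prog :=
  Seq (moves (only ord0 MoveLeft))
    (Seq (sweep ord0 (only ord0 MoveLeft)) (moves (only ord0 MoveRight))).

Lemma runs_finish base u s : written base u s ->
  runs finish s ((size u).*2 + 3) (shows u).
Proof.
move=> [H1 H2 H3]; apply: (@runs_weaken _ _ (1 + ((size u * 2).+1 + 1)) _ (shows u)) => //.
  lia.
apply: runs_seq; apply: runs_moves => s1 /(_ ord0); rewrite /only eqxx => -[C1 P1].
apply: runs_seq; apply: runs_sweep => [i Hi||s2 /(_ ord0)].
- rewrite C1 P1 H1 /only eqxx /=.
  have -> : base + (size u)%:Z + -1 * 1%:Z + -1 * i%:Z = base + (size u - i.+1)%N%:Z by lia.
  by rewrite H3 (nth_map true) //; lia.
- rewrite C1 P1 H1 /only eqxx /= -H2; congr (_ _); lia.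
rewrite /only eqxx => -[C2 P2].
apply: runs_moves => s3 /(_ ord0); rewrite /only eqxx => -[C3 P3] j.
rewrite C3 P3 C2 P2 C1 P1 H1 -H3 /=; congr (_ _); lia.
Qed.

End Programs.

(** * Polynomial bounds on running times *)

Definition poly_bounded (T : nat -> nat) : Prop :=
  exists p : {poly nat}, forall l, (T l <= p.[l])%N.

Lemma poly_bounded_const c : poly_bounded (fun=> c).
Proof. by exists c%:P => l; rewrite hornerC. Qed.

Lemma poly_bounded_id : poly_bounded id.
Proof. by exists 'X => l; rewrite hornerX. Qed.

Lemma poly_bounded_add S T : poly_bounded S -> poly_bounded T ->
  poly_bounded (fun l => S l + T l)%N.
Proof.
move=> [p Hp] [q Hq]; exists (p + q) => l; rewrite hornerD.
exact: leq_add.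
Qed.

Lemma poly_bounded_succ S : poly_bounded S -> poly_bounded (fun l => (S l).+1).
Proof.
move=> [p Hp]; exists (p + 1) => l.
by rewrite hornerD hornerC [leqRHS]addn1 ltnS.
Qed.

Lemma poly_bounded_mul S T : poly_bounded S -> poly_bounded T ->
  poly_bounded (fun l => S l * T l)%N.
Proof.
move=> [p Hp] [q Hq]; exists (p * q) => l; rewrite hornerM.
exact: leq_mul.
Qed.

Lemma poly_time_runs (A B : Type) (encA : A -> seq bool) (encB : B -> seq bool)
    (f : A -> B) (k : nat) (p : prog k) (T : nat -> nat) :
  poly_bounded T ->
  (forall a, runs p (@ainit k (encA a)) (T (size (encA a))) (shows (encB (f a)))) ->
  poly_time encA encB f.
Proof.
move=> [P HP] H; exists (compile p), P => a; apply: runs_computes.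
exact: runs_weaken (HP _) _ (H a).
Qed.

(** * Binary counting *)

Definition seq_content (s : seq cell) (j : int) : cell :=
  if j is Posz i then nth None s i else None.

(** Binary successor, least significant digit first: [find negb u] is the length of the carry. If
    all digits are ones, [drop] is empty and the number grows by one digit. *)
Definition binc (u : seq bool) : seq bool :=
  nseq (find negb u) false ++ true :: drop (find negb u).+1 u.

Lemma pos_bits_succ p : pos_bits (PosDef.Pos.succ p) = binc (pos_bits p).
Proof. by elim: p => [p IH|p _|] //=; [rewrite IH | rewrite /binc /= drop0]. Qed.

Lemma bits_succ n : bits n.+1 = binc (bits n).
Proof.
rewrite /bits; have := bin_of_natK n; case: (bin_of_nat n) => [<-|p <-] //.
have -> : (nat_of_bin (BinNums.Npos p)).+1 = nat_of_bin (BinNums.Npos (PosDef.Pos.succ p)).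
  by rewrite /= nat_of_succ_pos.
by rewrite nat_of_binK pos_bits_succ.
Qed.

Lemma size_binc u : (size (binc u) <= (size u).+1)%N.
Proof.
rewrite size_cat size_nseq /= size_drop; have := find_size negb u; lia.
Qed.

Lemma size_bits n : (size (bits n) <= n)%N.
Proof.
elim: n => // n IH; rewrite bits_succ; apply: leq_trans (size_binc _) _.
by rewrite ltnS.
Qed.

Lemma nth_set_nthE (T : Type) (x0 : T) s n y j :
  nth x0 (set_nth x0 s n y) j = if j == n then y else nth x0 s j.
Proof. by rewrite nth_set_nth. Qed.

Section BinaryCounter.

Local Notation tix := 'I_2.
Definition counter : tix := ord_max.

Definition write_counter (b : bool) (d : move) : prog 1 :=
  Do (fun r i => if i == counter then (Some b, d) else keep r i).

Definition increment : prog 1 :=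
  Seq (While (fun r => r counter == Some true) (write_counter false MoveRight))
  (Seq (write_counter true MoveLeft)
  (Seq (sweep counter (only counter MoveLeft)) (moves (only counter MoveRight)))).

Definition tape_at (ct : (int -> cell) * int) (s : seq cell) (h : int) : Prop :=
  (forall j, ct.1 j = seq_content s j) /\ ct.2 = h.

Lemma tape_at_same (ct ct' : (int -> cell) * int) s h :
  tape_at ct s h -> (forall j, ct'.1 j = ct.1 j) /\ ct'.2 = ct.2 -> tape_at ct' s h.
Proof. by move=> [H1 H2] [H3 H4]; split=> [j|]; rewrite ?H3 ?H4. Qed.

Lemma tape_at_write (ct : (int -> cell) * int) s h b d :
  tape_at ct s (Posz h) ->
  tape_at (fun j => if j == ct.2 then b else ct.1 j, ct.2 + d) (set_nth None s h b)
    (Posz h + d).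
Proof.
move=> [H1 H2]; split=> /= [j|]; rewrite H2 // H1.
by case: j => j //=; rewrite nth_set_nth.
Qed.

Lemma tape_at_eq ct s h s' h' : tape_at ct s h -> (forall j, nth None s j = nth None s' j) ->
  h = h' -> tape_at ct s' h'.
Proof. by move=> [H1 H2] H <-; split=> // -[] j; rewrite H1 //=. Qed.

Lemma runs_increment u ws h s (Q : atapes 1 -> Prop) :
  tape_at (s ord0) ws h -> tape_at (s counter) (map Some u) 0 ->
  (forall s', tape_at (s' ord0) ws h -> tape_at (s' counter) (map Some (binc u)) 0 ->
    Q s') ->
  runs increment s ((size u) * 4 + 4) Q.
Proof.
move=> H0 H1 HQ; set t := find negb u.
have tu : (t <= size u)%N by apply: find_size.
apply: (@runs_weaken _ _ _ ((t * 2).+1 + (1 + ((t * 2).+1 + 1))) _ Q) => //; first lia.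
apply: runs_seq.
pose Inv i (s' : atapes 1) := tape_at (s' ord0) ws h /\
  tape_at (s' counter) (nseq i (Some false) ++ drop i (map Some u)) i%:Z.
apply: (runs_weaken (leqnn _) _
  (runs_while (Inv := Inv) _ _ _)) => [s1|i s1 Hi [I0 I1]|s1 [I0 I1]|].
- move=> [I0 I1]; apply: runs_seq; apply: runs_do.
  set s2 := aact _ _.
  have J0 : tape_at (s2 ord0) ws h by apply: tape_at_same I0 _; exact: aact_keep.
  have J1 : tape_at (s2 counter) (map Some (binc u)) (t%:Z - 1).
    apply: (tape_at_eq (tape_at_write (Some true) (-1) I1)) => // j.
    rewrite nth_set_nthE !nth_cat size_nseq /binc -/t map_cat map_nseq nth_cat size_nseq.
    case: eqP => [->|E]; first by rewrite ltnn subnn.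
    case: ltnP => // Hj; have -> : (j - t = (j - t.+1).+1)%N by lia.
    by rewrite /= map_drop !nth_drop; congr nth; lia.
  clearbody s2; apply: runs_seq; apply: runs_sweep => [i Hi||s3 H3].
  + have [-> ->] := J1; rewrite /only eqxx /=.
    have -> : t%:Z - 1 + -1 * i%:Z = (t - i.+1)%N%:Z by lia.
    rewrite /= (nth_map true) //; rewrite /binc size_cat size_nseq -/t /=; lia.
  + have [-> ->] := J1; rewrite /only eqxx /=.
    by have -> : t%:Z - 1 + -1 * t%:Z = -1 by lia.
  + apply: runs_moves => s4 H4; apply: HQ.
      apply: tape_at_same J0 _; have [A1 A2] := H3 ord0; have [A3 A4] := H4 ord0.
      by split=> [j|]; rewrite ?A3 ?A1 // A4 A2 /only /=; lia.
    have [A1 A2] := H3 counter; have [A3 A4] := H4 counter; have [J2 J3] := J1.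
    split=> [j|]; first by rewrite A3 A1 J2.
    by rewrite A4 A2 J3 /only eqxx /=; lia.
- split.
    rewrite ffunE; have [-> ->] := I1; rewrite /= nth_cat size_nseq ltnn subnn.
    rewrite nth_drop addn0 (nth_map true); last lia.
    by have := before_find true Hi => /negbFE ->.
  apply: runs_do; split; first by apply: tape_at_same I0 _; exact: aact_keep.
  apply: (tape_at_eq (tape_at_write (Some false) 1 I1)); last lia.
  move=> j; rewrite nth_set_nthE !nth_cat !size_nseq.
  case: eqP => [->|E]; first by rewrite ltnSn nth_nseq ltnSn.
  rewrite !nth_nseq !nth_drop; have [Hj|Hj] := ltnP j i.
    by rewrite ltnS ltnW.
  by rewrite ltnS leqNgt ltn_neqAle (introN eqP) ?Hj /=; [congr nth; lia|lia].
- rewrite ffunE; have [-> ->] := I1; rewrite /= nth_cat size_nseq ltnn subnn.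
  rewrite nth_drop addn0.
  (* The carry stops at the first zero or, if there is none, at the blank behind the digits. *)
  have [Hh|Hh] := boolP (has negb u).
    by rewrite (nth_map true) -?has_find //; have := nth_find true Hh; case: (nth _ _ _).
  by rewrite nth_default // size_map /t hasNfind.
- by split; rewrite ?drop0.
Qed.

(** The counter is incremented once per input cell and then printed behind the input, each digit
    after the continuation bit [true] of [enc_seq]. *)
Definition count_bits : prog 1 :=
  Seq (While (nonblank ord0) (Seq increment (moves (only ord0 MoveRight))))
  (Seq (moves (only ord0 MoveRight))
  (Seq (While (nonblank counter)
         (Seq (writes (fun=> true))
         (Seq (writes (fun r => r counter == Some true))
              (moves (only counter MoveRight)))))
  (Seq (writes (fun=> false)) (@finish 1)))).

Definition count_bits_time (l : nat) : nat :=
  (l * (l * 4 + 4 + 1).+1).+1 + (1 + ((l * 4).+1 + (1 + (l * 4 + 5)))).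

Lemma runs_count_bits w :
  runs count_bits (@ainit 1 w) (count_bits_time (size w)) (shows (enc_nat (size w))).
Proof.
set l := size w; apply: runs_seq.
pose Inv i (s' : atapes 1) := tape_at (s' ord0) (map Some w) i%:Z /\
  tape_at (s' counter) (map Some (bits i)) 0.
apply: (runs_weaken (leqnn _) _
  (runs_while (Inv := Inv) _ _ _)) => [s [I0 I1]|i s Hi [I0 I1]|s [I0 I1]|].
- apply: runs_seq; apply: runs_moves => s1 H1.
  (* The blank at position [l] separates the output from the input. *)
  have J0 : written (l%:Z + 1) [::] s1.
    have [A1 A2] := H1 ord0; have [B1 B2] := I0.
    rewrite /written A2 B2 /only eqxx /=.
    split; first lia.
      rewrite A1 B1; have -> : l%:Z + 1 - 1 = l%:Z by lia.
      by rewrite /= nth_default // size_map.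
    move=> j; rewrite A1 B1; have -> : l%:Z + 1 + j%:Z = (l + 1 + j)%N%:Z by lia.
    by rewrite nth_nil /= nth_default // size_map -/l; lia.
  have {I1 H1} J1 : tape_at (s1 counter) (map Some (bits l)) 0.
    by apply: tape_at_same I1 _; have [A1 A2] := H1 counter; rewrite A2 /only mul0r addr0.
  set u := bits l in J1 *.
  have ul : (size u <= l)%N by apply: size_bits.
  pose Inv2 i (s' : atapes 1) :=
    written (l%:Z + 1) (flatten [seq [:: true; b] | b <- take i u]) s' /\
    tape_at (s' counter) (map Some u) i%:Z.
  apply: (@runs_weaken _ _ _ ((size u * 4).+1 + (1 + (l * 4 + 5))) _ (shows (enc_nat l))) => //.
    lia.
  apply: runs_seq; apply: (runs_weaken (leqnn _) _
    (runs_while (Inv := Inv2) _ _ _)) => [s2 [K0 K1]|i s2 Hi [K0 K1]|s2 [K0 K1]|].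
  + apply: runs_seq; apply: (runs_writes K0) => s3 L0 _.
    rewrite take_size in L0.
    have E : enc_nat l = rcons (flatten [seq [:: true; b] | b <- u]) false by [].
    rewrite E; apply: runs_weaken (runs_finish L0) => //.
    rewrite size_rcons (_ : size _ = (size u).*2); first lia.
    by elim: (u) => //= b v ->.
  + split; first by rewrite /nonblank ffunE; have [-> ->] := K1; rewrite /= (nth_map true).
    apply: (runs_seq (n1 := 1) (n2 := 2)); apply: (runs_writes K0) => s3 L0 F0.
    have L1 : tape_at (s3 counter) (map Some u) i by apply: tape_at_same K1 _; exact: F0.
    apply: (runs_seq (n1 := 1) (n2 := 1)); apply: (runs_writes L0) => s4 M0 F1.
    have M1 : tape_at (s4 counter) (map Some u) i by apply: tape_at_same L1 _; exact: F1.
    apply: runs_moves => s5 H5; split.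
      have [A1 A2] := H5 ord0; case: M0 => [M1' M2 M3].
      move: M1' M2 M3; rewrite ffunE; have [-> ->] := L1; rewrite /= (nth_map true) //.
      have -> (b : bool) : (Some b == Some true) = b by case: b.
      rewrite (take_nth true) // [map _ (rcons (take _ _) _)]map_rcons flatten_rcons.
      rewrite -!cats1 -catA => M0 M2 M3.
      split=> [||j]; rewrite ?A1 //.
      by rewrite A2 M0 /only /= mul0r addr0.
    have [A1 A2] := H5 counter; have [M2 M3] := M1.
    by split=> [j|]; [rewrite A1 M2 | rewrite A2 M3 /only eqxx /=; lia].
  + by rewrite /nonblank ffunE; have [-> ->] := K1; rewrite /= nth_default // size_map.
  + by split; rewrite ?take0.
- split; first by rewrite /nonblank ffunE; have [-> ->] := I0; rewrite /= (nth_map true).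
  apply: runs_seq.
  apply: (runs_weaken _ _ (runs_increment I0 I1 (fun s' => @conj _ _))).
    by have := size_bits i; rewrite /l; lia.
  move=> s1 [J0 J1]; apply: runs_moves => s2 H2.
  have [A1 A2] := H2 ord0; have [A3 A4] := H2 counter; split.
    have [B1 B2] := J0; split=> [j|]; first by rewrite A1 B1.
    by rewrite A2 B2 /only /=; lia.
  rewrite bits_succ; apply: tape_at_same J1 _; split; first exact: A3.
  by rewrite A4 /only /= mul0r addr0.
- by rewrite /nonblank ffunE; have [-> ->] := I0; rewrite /= nth_default // size_map.
- by split; split=> [[j|j]|] //=; rewrite nth_nil.
Qed.

End BinaryCounter.

(** The function of the theorem is the length of the encoding. *)
Lemma poly_time_size (A : Type) (encA : A -> seq bool) :
  poly_time encA enc_nat (fun a => size (encA a)).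
Proof.
apply: (poly_time_runs (p := count_bits) (T := count_bits_time)); last first.
  by move=> a; apply: runs_count_bits.
rewrite /count_bits_time.
do !first [apply: poly_bounded_id | apply: poly_bounded_const
  | apply: poly_bounded_succ | apply: poly_bounded_add | apply: poly_bounded_mul].
Qed.

(** * Scores of level votes *)

Section LinearOrders.

Variables (m : nat) (L : vote m).
Hypothesis Llin : linear_order L.

Lemma position_lt (a : 'I_m) : (position L a < m)%N.
Proof.
rewrite /position; set A := [set _ | _].
have : A \subset [set~ a] by apply/subsetP => b; rewrite !inE => /andP[].
move=> /subset_leq_card; rewrite cardsC1 card_ord; have := ltn_ord a.
lia.
Qed.

Lemma position_mono (a b : 'I_m) : a != b -> prefers L a b ->
  (position L a < position L b)%N.
Proof.
case: Llin => Ltr Las _ ab Lab; apply: proper_card; apply/properP; split.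
  apply/subsetP => x; rewrite !inE => /andP[xa Lxa].
  rewrite (Ltr _ _ _ Lxa Lab) andbT; apply: contra xa => /eqP xb; subst x.
  by apply/eqP; apply: Las; rewrite Lab Lxa.
by exists a; rewrite !inE ?eqxx // ab.
Qed.

Lemma position_inj : injective (position L).
Proof.
case: Llin => _ _ Ltot a b E; apply/eqP; apply/negPn/negP => ab.
have /orP[Lab|Lba] := Ltot a b.
  by have := position_mono ab Lab; rewrite E ltnn.
by rewrite eq_sym in ab; have := position_mono ab Lba; rewrite E ltnn.
Qed.

Lemma position_surj (i : nat) : (i < m)%N -> exists a, position L a = i.
Proof.
move=> im; pose f a := Ordinal (position_lt a).
have f_inj : injective f by move=> a b /(congr1 val) /= /position_inj.
have [g _ gK] := injF_bij f_inj.
by exists (g (Ordinal im)); have /(congr1 val) := gK (Ordinal im).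
Qed.

End LinearOrders.

(** * Votes given by maximal and minimal candidates *)

Section LevelVotes.

Variables (m : nat) (X Y : pred 'I_m).

(* Its maximal elements are those of [X] and its minimal elements those of [Y];
   the elements of both sets are isolated. *)
Definition level_vote : vote m :=
  [set u | [&& ~~ Y u.1, ~~ X u.2 & X u.1 || Y u.2]].

Lemma level_voteE a b :
  prefers level_vote a b = [&& ~~ Y a, ~~ X b & X a || Y b].
Proof. by rewrite /prefers inE. Qed.

Lemma level_vote_partial : partial_vote level_vote.
Proof.
split=> [b a c|a b]; rewrite !level_voteE.
  by case: (Y a); case: (X a); case: (Y b); case: (X b); case: (X c); case: (Y c).
by case: (Y a); case: (X a); case: (Y b); case: (X b).
Qed.

(** The vote ranks [t], which is in [X] but not in [Y], above every candidate outside [X]. *)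
Lemma level_vote_first (L : vote m) (t a : 'I_m) : linear_order L ->
  level_vote \subset L -> X t -> ~~ Y t -> position L a = 0%N -> X a.
Proof.
move=> Llin /subsetP sub Xt Yt pa; apply/negPn/negP => Xa.
have /sub Lta : (t, a) \in level_vote by rewrite inE /= Xt Yt Xa.
have ta : t != a by apply: contraNneq Xa => <-.
by have := position_mono Llin ta Lta; rewrite pa.
Qed.

Lemma level_vote_last (L : vote m) (t a : 'I_m) : linear_order L ->
  level_vote \subset L -> Y t -> ~~ X t -> position L a = m.-1 -> Y a.
Proof.
move=> Llin /subsetP sub Yt Xt pa; apply/negPn/negP => Ya.
have /sub Lta : (a, t) \in level_vote by rewrite inE /= Yt Xt Ya orbT.
have ta : a != t by apply: contraNneq Ya => ->.
have := position_mono Llin ta Lta; have := position_lt L t; rewrite pa; lia.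
Qed.

Lemma level_vote_extend (x y : 'I_m) : X x -> Y y -> x != y ->
  exists L : vote m, [/\ linear_order L, level_vote \subset L,
    position L x = 0%N & position L y = m.-1].
Proof.
move=> Xx Yy xy.
(* From the top: [x], the rest of [X] alone, the candidates in neither or both sets, the rest of [Y]
   alone, [y]. Ties are broken by index. Isolated candidates fit anywhere, hence also at an end when
   chosen as [x] or [y]. *)
pose key a := if a == x then 0%N else if a == y then 4%N else
  if X a && ~~ Y a then 1%N else if Y a && ~~ X a then 3%N else 2%N.
pose r (a b : 'I_m) := (key a < key b)%N || ((key a == key b) && (a <= b)%N).
pose L : vote m := [set u | r u.1 u.2].
have LE a b : prefers L a b = r a b by rewrite /prefers inE.
have Llin : linear_order L.
  split=> [b a c|a b|a b]; rewrite !LE /r.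
  - lia.
  - by move=> H; apply/val_inj => /=; lia.
  - lia.
exists L; split=> //.
- apply/subsetP => -[a b]; rewrite !inE /= => /and3P[Ya Xb XY].
  have ay : a != y by apply: contraNneq Ya => ->.
  have bx : b != x by apply: contraNneq Xb => ->.
  rewrite /r /key (negbTE ay) (negbTE bx) Ya (negbTE Ya) (negbTE Xb) /= andbT.
  case: (a == x); case: (b == y) => //=; move: XY; case: (X a); case: (Y b) => //=.
- apply/eqP; rewrite cards_eq0; apply/eqP/setP => b; rewrite !inE.
  have [//|bx /=] := eqVneq b x; rewrite /prefers inE /r /key /= eqxx (negbTE bx).
  by case: ifP => // _; case: ifP => // _; case: ifP.
- rewrite /position (_ : [set _ | _] = [set~ y]) ?cardsC1 ?card_ord //.
  apply/setP => b; rewrite !inE; have [//|by_ /=] := eqVneq b y.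
  rewrite /prefers inE /r /key /= eqxx (negbTE by_) [y == x]eq_sym (negbTE xy).
  by case: ifP => // _; case: ifP => // _; case: ifP.
Qed.

End LevelVotes.

Section LevelInstances.

Variables (m : nat) (X Y : 'I_m -> pred 'I_m).

Definition level_profile : seq (vote m) :=
  [seq level_vote (X p) (Y p) | p <- enum 'I_m].

Lemma level_profile_partial v : v \in level_profile -> partial_vote v.
Proof. by case/mapP => p _ ->; apply: level_vote_partial. Qed.

Definition level_instance (c : 'I_m) : pw_instance :=
  PWInstance c level_profile_partial.

Lemma size_level_profile : size level_profile = m.
Proof. by rewrite size_map size_enum_ord. Qed.

(** There is exactly one vote per candidate, in the order of the candidates, so completions can be
    indexed by candidates instead of places in the list. *)
Lemma possible_winner_profile (alpha : seq int) (c : 'I_m) :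
  possible_winner alpha (level_instance c) <->
  exists L : 'I_m -> vote m,
    (forall p, linear_order (L p) /\ level_vote (X p) (Y p) \subset L p) /\
    (forall a, score alpha L a <= score alpha L c).
Proof.
have tE p : tnth (in_tuple level_profile) (cast_ord (esym size_level_profile) p) =
    level_vote (X p) (Y p).
  rewrite (tnth_nth set0) /= (nth_map p) ?size_enum_ord //.
  by rewrite nth_ord_enum.
have scoreE (L : 'I_(size level_profile) -> vote m) a :
    score alpha L a = score alpha (L \o cast_ord (esym size_level_profile)) a.
  rewrite /score (reindex (cast_ord (esym size_level_profile))) //=.
  by exists (cast_ord size_level_profile) => i _; apply/val_inj.
split=> [[L [H1 H2]]|[L [H1 H2]]].
  exists (L \o cast_ord (esym size_level_profile)); split=> [p|a].
    by rewrite -tE; apply: H1.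
  by rewrite -!scoreE; apply: H2.
have LE : (L \o cast_ord size_level_profile) \o cast_ord (esym size_level_profile) =1 L.
  by move=> p /=; congr L; apply/val_inj.
exists (L \o cast_ord size_level_profile); split=> [i|a].
  have [H3 H4] := H1 (cast_ord size_level_profile i); split=> //=.
  by rewrite -(cast_ordK size_level_profile i) tE /= cast_ordKV.
rewrite !scoreE; have {}LE b : score alpha ((L \o cast_ord size_level_profile) \o
    cast_ord (esym size_level_profile)) b = score alpha L b.
  by apply: eq_bigr => p _; rewrite LE.
by rewrite !LE.
Qed.

End LevelInstances.

(** * Scores as counts of first and last places *)

Section FirstsAndLasts.

Variables (m : nat) (alpha : seq int).
Hypotheses (m2 : (2 < m)%N) (size_alpha : size alpha = m).
Hypotheses (alpha_sv : is_scoring_vector alpha).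
Hypotheses (alpha_mid : alpha`_1 = alpha`_(m.-2)) (alpha_last : alpha`_(m.-1) = 0).

(** Monotonicity squeezes the inner entries between the equal values at [1] and [m.-2]. *)
Lemma scoring_vector_middle i : (0 < i < m.-1)%N -> alpha`_i = alpha`_1.
Proof.
move=> Hi.
have anti (j l : nat) : (j <= l < m)%N -> alpha`_l <= alpha`_j.
  move=> jl; apply: (@sorted_leq_nth _ (fun x y => y <= x)).
  - by move=> x y z H1 H2; apply: le_trans H2 H1.
  - by [].
  - exact: alpha_sv.
  - by rewrite inE size_alpha; lia.
  - by rewrite inE size_alpha; lia.
  - by case/andP: jl.
by apply/eqP; rewrite eq_le anti; last lia; rewrite alpha_mid anti //; lia.
Qed.

Lemma alpha_position (L : vote m) (u v a : 'I_m) : linear_order L ->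
  position L u = 0%N -> position L v = m.-1 ->
  alpha`_(position L a) =
    alpha`_1 + (alpha`_0 - alpha`_1) * (u == a)%:R - alpha`_1 * (v == a)%:R.
Proof.
move=> Llin pu pv; have [ua|ua] := eqVneq u a.
  have -> : (v == a) = false by apply/eqP => va; move: pv; rewrite va -ua pu; lia.
  by rewrite -ua pu; lia.
have pa0 : position L a <> 0%N.
  by rewrite -pu => /(position_inj Llin) E; rewrite E eqxx in ua.
have [va|va] := eqVneq v a; first by rewrite -va pv alpha_last; lia.
have pa1 : position L a <> m.-1.
  by rewrite -pv => /(position_inj Llin) E; rewrite E eqxx in va.
rewrite scoring_vector_middle; last by have := position_lt L a; lia.
lia.
Qed.

Definition occurrences (f : 'I_m -> 'I_m) (a : 'I_m) : nat := #|[set p | f p == a]|.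

Lemma occurrencesE (f : 'I_m -> 'I_m) a :
  (occurrences f a)%:Z = \sum_p (f p == a)%:R :> int.
Proof.
rewrite -natz /occurrences -sum1_card natr_sum big_mkcond /=.
by apply: eq_bigr => p _; rewrite inE; case: eqP.
Qed.

Lemma score_firsts_lasts (L : 'I_m -> vote m) (u v : 'I_m -> 'I_m) a :
  (forall p, [/\ linear_order (L p), position (L p) (u p) = 0%N
                & position (L p) (v p) = m.-1]) ->
  score alpha L a = alpha`_1 *+ m +
    ((alpha`_0 - alpha`_1) * (occurrences u a)%:Z - alpha`_1 * (occurrences v a)%:Z).
Proof.
move=> H; rewrite /score (eq_bigr (fun p => alpha`_1 +
    ((alpha`_0 - alpha`_1) * (u p == a)%:R - alpha`_1 * (v p == a)%:R))).
  by rewrite big_split /= sumr_const card_ord sumrB -!mulr_sumr !occurrencesE.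
by move=> p _; have [H1 H2 H3] := H p; rewrite addrA; apply: alpha_position.
Qed.

Variables (X Y : 'I_m -> pred 'I_m) (c : 'I_m).
Hypothesis X_top : forall p, exists t, X p t && ~~ Y p t.
Hypothesis Y_bot : forall p, exists t, Y p t && ~~ X p t.

(** Scores depend only on who is first and who is last in each vote. By [X_top] and [Y_bot] every
    completion makes admissible choices of both, and [level_vote_extend] realizes all admissible
    choices. *)
Lemma possible_winner_firsts_lasts :
  possible_winner alpha (level_instance X Y c) <->
  exists u v : 'I_m -> 'I_m,
    (forall p, [/\ X p (u p), Y p (v p) & u p != v p]) /\
    (forall a, (alpha`_0 - alpha`_1) * (occurrences u a)%:Z
                 - alpha`_1 * (occurrences v a)%:Z <=
               (alpha`_0 - alpha`_1) * (occurrences u c)%:Z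
                 - alpha`_1 * (occurrences v c)%:Z).
Proof.
rewrite possible_winner_profile; split=> [[L [HL Hc]]|[u [v [Huv Hc]]]].
  have exu p : exists a, position (L p) a == 0%N.
    have [|a Ha] := position_surj (HL p).1 (i := 0%N); first lia.
    by exists a; apply/eqP.
  have exv p : exists a, position (L p) a == m.-1.
    have [|a Ha] := position_surj (HL p).1 (i := m.-1); first lia.
    by exists a; apply/eqP.
  pose u p := xchoose (exu p); pose v p := xchoose (exv p).
  have Hu p : position (L p) (u p) = 0%N by apply/eqP/(xchooseP (exu p)).
  have Hv p : position (L p) (v p) = m.-1 by apply/eqP/(xchooseP (exv p)).
  exists u, v; split=> [p|a].
    have [Llin Lsub] := HL p; split.
    - by have [t /andP[]] := X_top p => Xt Yt; apply: (level_vote_first Llin Lsub Xt Yt).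
    - by have [t /andP[]] := Y_bot p => Yt Xt; apply: (level_vote_last Llin Lsub Yt Xt).
    - by apply/eqP => E; move: (Hu p); rewrite E Hv; lia.
  have HLuv p : [/\ linear_order (L p), position (L p) (u p) = 0%N
                & position (L p) (v p) = m.-1] by split=> //; apply: (HL p).1.
  by have := Hc a; rewrite !(score_firsts_lasts _ HLuv) lerD2l.
have /fin_all_exists[L HL] p := level_vote_extend
  (let: And3 H _ _ := Huv p in H) (let: And3 _ H _ := Huv p in H)
  (let: And3 _ _ H := Huv p in H).
exists L; split=> [p|a]; first by have [? ? _ _] := HL p.
have HLuv p : [/\ linear_order (L p), position (L p) (u p) = 0%N
              & position (L p) (v p) = m.-1] by have [? _ ? ?] := HL p.
by rewrite !(score_firsts_lasts _ HLuv) lerD2l; apply: Hc.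
Qed.

End FirstsAndLasts.

(** * The votes of the reduction *)

Section Reduction.

Local Open Scope nat_scope.

Variables (n k : nat) (bit : nat -> bool).

Local Notation s := (n.+1).
Local Notation h := (k.+1 * n.+1)%N.
Local Notation m := (h.+3).

Definition set_pos (p : nat) : bool := (n < p < h)%N.

Definition pool (a : nat) : bool := (a < n)%N && (a %% 3 == 2)%N.

(* In the vote of [p], [topset p] and [botset p] are the sets of maximal and of
   minimal candidates. The positions [p < n] are the elements, [n] is the
   distinguished candidate, and row [r] consists of the positions
   [r.+1 * s + o], with the prefix at [o = 0] and element [e] at [o = e.+1].
   The candidate [h] is the sink, [h.+1] always leads its own vote and so no
   other, and [h.+2] is last in the vote of the sink. *)
Definition topset (p a : nat) : bool :=
  if (p < n)%N then (a == h.+1) || [&& set_pos a, bit a & s %| a - p.+1]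
  else if set_pos p then (a == p) || (if s %| p then pool a else a.+1 == p)
  else a == p.

Definition botset (p a : nat) : bool :=
  [|| (a == h) && (p != h), (a == p) && set_pos p | (p == h) && (a == h.+2)].

(** Quotient [0] belongs to the elements and the distinguished candidate, so row [0] has quotient
    [1]. *)
Definition row (p : nat) : nat := (p %/ s).-1.

Lemma set_posE p : set_pos p -> p = ((row p).+1 * s + p %% s)%N /\ (row p < k)%N.
Proof.
move=> /andP[np ph].
have r0 : (0 < p %/ s)%N by rewrite divn_gt0.
have r1 : (p %/ s < k.+1)%N by rewrite ltn_divLR.
rewrite /row prednK // -divn_eq; split=> //; lia.
Qed.

Lemma set_pos_intro j o : (j < k)%N -> (o < s)%N ->
  [/\ set_pos (j.+1 * s + o), row (j.+1 * s + o) = j & (s %| j.+1 * s + o) = (o == 0)%N].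
Proof.
move=> jk os; have H : (j.+2 * s <= h)%N by rewrite leq_mul2r ltnS jk orbT.
split.
- rewrite /set_pos; move: H; rewrite !mulSn; lia.
- by rewrite /row divnMDl // divn_small // addn0.
- by rewrite dvdn_addr ?dvdn_mull // /dvdn modn_small.
Qed.

Let c : 'I_m := inord n.

Let nh : (n < h)%N. Proof. by rewrite mulSn; lia. Qed.

Let cE : c = n :> nat. Proof. by rewrite inordK; lia. Qed.

Lemma topset_top (n_big : 0 < k -> 2 < n) (p : 'I_m) :
  exists t : 'I_m, topset p t && ~~ botset p t.
Proof.
suff [t tm Ht] : exists2 t : nat, (t < m)%N & topset p t && ~~ botset p t.
  by exists (Ordinal tm).
rewrite /topset /botset; case: (ltnP p n) => pn.
  by exists h.+1; rewrite /set_pos; lia.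
case: (boolP (set_pos p)) => sp; last first.
  by exists p; rewrite ?ltn_ord //; move: sp; rewrite /set_pos; have := ltn_ord p; lia.
have n2 : (2 < n)%N.
  by apply: n_big; have [_ H] := set_posE sp; apply: leq_ltn_trans H.
case: (boolP (s %| p)) => _.
  (* In its own vote [p] is both maximal and minimal, so another witness is required: here the pool
     candidate [2], and for a non-prefix the predecessor. *)
  by exists 2; rewrite /pool; move: sp; rewrite /set_pos; lia.
by exists p.-1; move: sp; rewrite /set_pos; lia.
Qed.

Lemma botset_bot (p : 'I_m) : exists t : 'I_m, botset p t && ~~ topset p t.
Proof.
suff [t tm Ht] : exists2 t : nat, (t < m)%N & botset p t && ~~ topset p t.
  by exists (Ordinal tm).
rewrite /topset /botset /set_pos; have [ph|ph] := eqVneq (p : nat) h.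
  exists h.+2; first by [].
  rewrite ph; have -> : (h < n) = false by lia.
  have -> : (n < h < h) = false by lia.
  lia.
exists h; first lia; rewrite eqxx /= /pool; case: ifP => pn; first by lia.
by case: ifP => sp; [case: ifP => _; lia | lia].
Qed.

(** * From a winning completion to a cover *)

Section FromWinner.

Variables (u v : 'I_m -> 'I_m) (A B : int).
Hypothesis uv : forall p : 'I_m, [/\ topset p (u p), botset p (v p) & u p != v p].

Lemma occurrences_first_dist : occurrences u c = 1%N.
Proof.
rewrite /occurrences (_ : [set _ | _] = [set c]) ?cards1 //.
apply/setP => p; rewrite !inE; apply/eqP/eqP => [E|->].
  have [+ _ _] := uv p; rewrite E /topset /pool /set_pos; case: ifP => pn.
    by rewrite cE; lia.
  case: ifP => sp; last by move=> /eqP /val_inj.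
  case: ifP => [|dp]; first by rewrite cE; lia.
  (* The distinguished candidate [n] precedes only [s], which is a prefix and has the pool in place
     of its predecessor. *)
  rewrite cE => H; have Ep : p = s :> nat by lia.
  by move: dp; rewrite Ep dvdnn.
have [+ _ _] := uv c; rewrite /topset /set_pos cE ltnn /= => /eqP E.
by apply/val_inj; rewrite /= E cE.
Qed.

Lemma occurrences_last_dist : occurrences v c = 0%N.
Proof.
apply/eqP; rewrite cards_eq0; apply/eqP/setP => p; rewrite !inE.
apply/eqP => E; have [_ + _] := uv p; rewrite E /botset /set_pos cE; lia.
Qed.

Hypothesis A0 : (0 < A)%R.
Hypothesis winner : forall a,
  (A * (occurrences u a)%:Z - B * (occurrences v a)%:Z <=
   A * (occurrences u c)%:Z - B * (occurrences v c)%:Z)%R.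

(** A candidate that is never last scores [A] for each first place, and the distinguished candidate
    gets [A] in all. *)
Lemma first_uniq a p q : (forall r, v r != a) -> u p = a -> u q = a -> p = q.
Proof.
move=> Ha up uq; have := winner a.
rewrite occurrences_first_dist occurrences_last_dist.
have -> : occurrences v a = 0%N.
  by apply/eqP; rewrite cards_eq0; apply/eqP/setP => r; rewrite !inE (negbTE (Ha r)).
rewrite mulr0 !subr0 mulr1 -[leRHS]mulr1 ler_pM2l // lez_nat => H.
by apply: (card_le1_eqP H); rewrite inE ?up ?uq.
Qed.

Lemma set_pos_last (p a : 'I_m) : set_pos a -> v p = a -> p = a.
Proof.
move=> sa E; have [_ + _] := uv p; rewrite E /botset => H.
apply/val_inj => /=; move: sa H; rewrite /set_pos; lia.
Qed.

(** A candidate of a row can be last only in its own vote; leading that vote, it is never last, and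
    [first_uniq] applies. *)
Lemma blocked_set_pos (a p : 'I_m) : set_pos a -> u a = a -> u p = a -> p = a.
Proof.
move=> sa ua up; apply: (first_uniq (a := a)) => // r; apply/eqP => vr.
have E := set_pos_last sa vr; rewrite E in vr.
by have [_ _] := uv a; rewrite ua vr eqxx.
Qed.

(** Induction along the row: a candidate leading its own vote cannot lead that of its successor,
    which must then lead its own vote as well. *)
Lemma chain j o : (j < k)%N -> (o < s)%N ->
  u (inord (j.+1 * s)) = inord (j.+1 * s) ->
  u (inord (j.+1 * s + o)) = inord (j.+1 * s + o).
Proof.
move=> jk + H; elim: o => [|o IH] os; first by rewrite addn0.
have [sp rp dp] := set_pos_intro jk os.
have [sq _ _] := set_pos_intro jk (ltnW os).
have pm : (j.+1 * s + o.+1 < m)%N by move: sp; rewrite /set_pos; lia.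
have qm : (j.+1 * s + o < m)%N by lia.
have [+ _ _] := uv (inord (j.+1 * s + o.+1)); rewrite /topset inordK // sp dp /=.
have -> : (j.+1 * s + o.+1 < n)%N = false by move: sp; rewrite /set_pos; lia.
move=> /orP[/eqP E|/eqP E]; first by apply/val_inj; rewrite /= E inordK.
have /(congr1 val) : inord (j.+1 * s + o.+1) = inord (j.+1 * s + o) :> 'I_m.
  apply: blocked_set_pos; rewrite ?inordK // ?IH ?(ltnW os) //.
  by apply/val_inj => /=; rewrite inordK //; lia.
by rewrite /= !inordK //; lia.
Qed.

(** The vote of [e] is not led by [h.+1], which is never last and already leads its own vote. So a
    candidate in column [e] of some row leads it, and the prefix of that row has to draw on the
    pool. *)
Lemma first_in_row (e : nat) : (e < n)%N ->
  exists j, [/\ (j < k)%N, bit (j.+1 * s + e.+1) & pool (u (inord (j.+1 * s)))].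
Proof.
move=> en; have em : (e < m)%N by lia.
have zm : (h.+1 < m)%N by lia.
pose z : 'I_m := inord h.+1.
have zE : z = h.+1 :> nat by rewrite inordK.
have uz : u z = z.
  have [+ _ _] := uv z; rewrite /topset /set_pos zE.
  have -> : (h.+1 < n)%N = false by lia.
  have -> : (n < h.+1 < h)%N = false by lia.
  by move=> /eqP E; apply/val_inj; rewrite /= E zE.
have [+ _ _] := uv (inord e); rewrite /topset inordK // en.
set a := u (inord e) => /orP[/eqP az|/and3P[sa ba da]].
  have /(congr1 val) : inord e = z.
    apply: (first_uniq (a := z)) => // [r|]; last by apply/val_inj; rewrite /= zE.
    by apply/eqP => E; have [_ + _] := uv r; rewrite E /botset /set_pos zE; lia.
  by rewrite /= zE inordK //; lia.
have [aE rk] := set_posE sa.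
have oE : (a %% s = e.+1)%N.
  have ea : (e.+1 <= a)%N by move: sa; rewrite /set_pos; lia.
  by rewrite -(subnK ea) -modnDml (eqP da) add0n modn_small // ltnS.
rewrite oE in aE; exists (row a); split=> //; first by rewrite -aE.
have [sp _ dp] := set_pos_intro rk (ltn0Sn n); rewrite addn0 in sp dp.
have pm : ((row a).+1 * s < m)%N by move: sp; rewrite /set_pos; lia.
have [+ _ _] := uv (inord ((row a).+1 * s)); rewrite /topset inordK // sp dp /=.
have -> : ((row a).+1 * s < n)%N = false by move: sp; rewrite /set_pos; lia.
(* If the prefix led its own vote, then by [chain] so would [a], which could not lead the vote of
   [e] in addition. *)
move=> /orP[/eqP E|//].
have := @chain (row a) e.+1 rk _; rewrite -aE inord_val => /(_ _ _) ua.
have : inord e = a.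
  apply: blocked_set_pos => //; apply: ua; first by rewrite ltnS.
  by apply/val_inj; rewrite /= E inordK.
by move=> /(congr1 val); rewrite /= inordK // => E2; move: sa; rewrite /set_pos -E2; lia.
Qed.

(** Pool candidates are never last, so each leads at most one vote. Being congruent to [2] modulo
    [3], they are determined by their quotients by [3]. *)
Lemma pool_rows_inj j j' : (j < k)%N -> (j' < k)%N ->
  pool (u (inord (j.+1 * s))) ->
  (u (inord (j.+1 * s)) %/ 3 = u (inord (j'.+1 * s)) %/ 3)%N ->
  pool (u (inord (j'.+1 * s))) -> j = j'.
Proof.
move=> jk jk' /andP[H1 H2] E /andP[H3 H4].
have E2 : u (inord (j.+1 * s)) = u (inord (j'.+1 * s)) by apply/val_inj => /=; lia.
have : inord (j.+1 * s) = inord (j'.+1 * s) :> 'I_m.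
  apply: (first_uniq (a := u (inord (j'.+1 * s)))) => // r; apply/eqP => E3.
  have [_ + _] := uv r; rewrite E3 /botset.
  by move: H3; rewrite /set_pos; lia.
have lt i : (i < k)%N -> (i.+1 * s < m)%N.
  by move=> ik; have [+ _ _] := set_pos_intro ik (ltn0Sn n); rewrite /set_pos; lia.
move=> /(congr1 val); rewrite /= !inordK ?lt // => /eqP.
by rewrite eqn_pmul2r // eqSS => /eqP.
Qed.

End FromWinner.

(** * From a cover to a winning completion *)

Section ToWinner.

(** [chosen] marks the sets of the cover, [rank] numbers them, and [setof] gives a chosen set
    containing an element. *)
Variables (chosen : nat -> bool) (rank : nat -> nat) (setof : nat -> nat).
Hypothesis rank_lt : forall j, (j < k)%N -> chosen j -> (3 * rank j + 2 < n)%N.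
Hypothesis rank_inj : forall i j, (i < k)%N -> (j < k)%N -> chosen i -> chosen j ->
  rank i = rank j -> i = j.
Hypothesis setofP : forall e, (e < n)%N ->
  [/\ (setof e < k)%N, chosen (setof e) & bit ((setof e).+1 * s + e.+1)].

(** A chosen row is shifted by one: a pool candidate leads the vote of the prefix, and each
    candidate of the row that of its successor in the row. Each may then lead the vote of its
    element too, paying for this by the last place in its own vote. *)
Definition first_nat (p : nat) : nat :=
  if (p < n)%N then (setof p).+1 * s + p.+1
  else if set_pos p && chosen (row p) then
    if s %| p then 3 * rank (row p) + 2 else p.-1
  else p.

Definition last_nat (p : nat) : nat :=
  if set_pos p && chosen (row p) then p else if p == h then h.+2 else h.

Lemma first_nat_top p : (p < m)%N -> topset p (first_nat p) /\ (first_nat p < m)%N.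
Proof.
move=> pm; rewrite /topset /first_nat; case: (ltnP p n) => pn.
  have [jk _ b] := setofP pn.
  have [sp _ _] := set_pos_intro jk (pn : (p.+1 < s)%N).
  rewrite sp b addnK dvdn_mull // orbT; split=> //.
  by move: sp; rewrite /set_pos; lia.
case: (boolP (set_pos p)) => [sp|_] /=; last by rewrite eqxx.
have [_ rk] := set_posE sp.
case: (boolP (chosen (row p))) => [ch|_]; last by rewrite eqxx.
case: (s %| p); last by move: sp; rewrite /set_pos; lia.
by have := rank_lt rk ch; rewrite /pool; lia.
Qed.

Lemma last_nat_bot p : (p < m)%N -> botset p (last_nat p) /\ (last_nat p < m)%N.
Proof.
move=> pm; rewrite /botset /last_nat.
case: (boolP (set_pos p)) => sp /=; first case: (chosen (row p)) => /=.
- by rewrite eqxx orbT.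
- by case: (eqVneq p h) => ph; rewrite ?eqxx ?orbT //; split=> //; lia.
- by case: (eqVneq p h) => ph; rewrite ?eqxx ?orbT //; split=> //; lia.
Qed.

Lemma first_last_neq p : (p < m)%N -> first_nat p != last_nat p.
Proof.
move=> pm; rewrite /first_nat /last_nat; case: ifP => pn.
  have [jk _ _] := setofP pn.
  have [sp _ _] := set_pos_intro jk (pn : (p.+1 < s)%N).
  have -> : set_pos p = false by rewrite /set_pos; lia.
  by move: sp; rewrite /set_pos; case: ifP; lia.
have [sp /=|sp /=] := boolP (set_pos p).
  have [_ rk] := set_posE sp.
  case: ifP => [ch|_]; last by move: sp; rewrite /set_pos; case: ifP; lia.
  case: ifP => _; last by move: sp; rewrite /set_pos; lia.
  by have := rank_lt rk ch; move: sp; rewrite /set_pos; lia.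
by case: ifP; lia.
Qed.

(* The only candidates with two first places sit in a chosen row; they are last
   in their own vote. *)
Lemma first_nat_cases p a : (p < m)%N -> first_nat p = a ->
  [\/ [/\ set_pos a, chosen (row a) & p = a.+1 \/ p = (a %% s).-1],
      [/\ (a < n)%N, set_pos p, s %| p & chosen (row p)] /\ a = (3 * rank (row p) + 2)%N |
      p = a /\ (set_pos a -> ~~ chosen (row a))].
Proof.
move=> pm; rewrite /first_nat; case: ifP => pn.
  move=> <-; apply: Or31; have [jk ch b] := setofP pn.
  have [sp rp _] := set_pos_intro jk (pn : (p.+1 < s)%N).
  rewrite sp rp ch; split=> //; right.
  by rewrite modnMDl modn_small.
have [sp /=|sp /= <-] := boolP (set_pos p); last first.
  by apply: Or33; split=> // sp'; rewrite sp' in sp.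
have [pE rk] := set_posE sp.
case: ifP => [ch|/negbT ch <-]; last by apply: Or33.
case: ifP => [dp <-|dp <-].
  by apply: Or32; split=> //; split=> //; apply: rank_lt.
apply: Or31.
have o0 : (0 < p %% s)%N by rewrite lt0n; apply/eqP => E; rewrite /dvdn E in dp.
have os : ((p %% s).-1 < s)%N by have := ltn_pmod p (ltn0Sn n); lia.
have [] := set_pos_intro rk os.
have -> : ((row p).+1 * s + (p %% s).-1 = p.-1)%N by lia.
move=> sa ra _; rewrite sa ra; split=> //; left; lia.
Qed.

(** With [F] first and [G] last places, [F <= G + 1] yields [A F - B G <= A + (A - B) G <= A]. *)
Lemma winner_bound (u v : 'I_m -> 'I_m) (A B : int) :
  (forall p : 'I_m, u p = first_nat p :> nat) ->
  (forall p : 'I_m, v p = last_nat p :> nat) ->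
  (0 < A)%R -> (A <= B)%R ->
  forall a, (A * (occurrences u a)%:Z - B * (occurrences v a)%:Z <= A)%R.
Proof.
move=> uE vE A0 AB a.
suff : (occurrences u a <= (occurrences v a).+1)%N by nia.
have [/andP[sa ch]|nch] := boolP (set_pos a && chosen (row a)).
  have H1 : (0 < occurrences v a)%N.
    apply/card_gt0P; exists a; rewrite inE; apply/eqP/val_inj.
    by rewrite /= vE /last_nat sa ch.
  suff : (occurrences u a <= 2)%N by lia.
  (* Only two votes are possible: that of the successor and that of the element whose column
     contains [a]. For a prefix the second index is spurious, but only an upper bound is needed. *)
  have sub : [set p | u p == a] \subset [set inord a.+1; inord (a %% s).-1].
    apply/subsetP => p; rewrite !inE => /eqP up.
    have /first_nat_cases : first_nat p = a by rewrite -uE up.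
    case/(_ (ltn_ord p)) => [[_ _ E]|[[an _ _ _] _]|[E Hn]].
    - apply/orP; rewrite -!(inj_eq val_inj) /=.
      case: E => E; [left|right]; apply/eqP; rewrite inordK //; rewrite -E; exact: ltn_ord.
    - by move: sa an; rewrite /set_pos; lia.
    - by have := Hn sa; rewrite ch.
  by apply: leq_trans (subset_leq_card sub) _; rewrite cards2; case: eqP.
suff : (occurrences u a <= 1)%N by lia.
apply/card_le1_eqP => p q; rewrite !inE => /eqP up /eqP uq; apply/val_inj => /=.
have {}up : first_nat p = a by rewrite -uE up.
have {}uq : first_nat q = a by rewrite -uE uq.
have Hc : set_pos a -> chosen (row a) -> False by move=> H1 H2; rewrite H1 H2 in nch.
have [[H1 H2 _]|[[an sp dp cp] Ep]|[Ep _]] := first_nat_cases (ltn_ord p) up;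
  first by case: (Hc H1 H2).
all: have [[H1 H2 _]|[[an' sq dq cq] Eq]|[Eq _]] := first_nat_cases (ltn_ord q) uq;
  try by case: (Hc H1 H2).
(* Two prefixes whose votes are led by the same pool candidate have the same rank, hence the same
   row. *)
- have [pE pk] := set_posE sp; have [qE qk] := set_posE sq.
  have Er : row p = row q by apply: rank_inj => //; lia.
  by rewrite pE qE Er (eqP dp) (eqP dq).
- by have [_ _] := setofP an; move: uq up; rewrite Eq /first_nat an; lia.
- by have [_ _] := setofP an'; move: up; rewrite Ep /first_nat an'; lia.
- by rewrite Ep Eq.
Qed.

End ToWinner.

End Reduction.

(** * The X3C encoding as a table *)

Lemma size_flatten_uniform (T : eqType) (ss : seq (seq T)) l :
  {in ss, forall r, size r = l} -> size (flatten ss) = (size ss * l)%N.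
Proof.
elim: ss => //= r ss IH H; rewrite size_cat H ?mem_head // IH // => x xs.
by apply: H; rewrite inE xs orbT.
Qed.

Lemma nth_flatten_uniform (T : eqType) (x0 : T) (ss : seq (seq T)) l i j :
  {in ss, forall r, size r = l} -> (i < size ss)%N -> (j < l)%N ->
  nth x0 (flatten ss) (i * l + j) = nth x0 (nth [::] ss i) j.
Proof.
elim: ss i => //= r ss IH [|i] H iss jl.
  by rewrite nth_cat H ?mem_head // jl.
rewrite nth_cat H ?mem_head // mulSn -addnA ltnNge leq_addr /= addKn IH // => x xs.
by apply: H; rewrite inE xs orbT.
Qed.

Section Encoding.

Variable I : x3c.

Local Notation n := (x3c_n I).
Local Notation k := (size (x3c_sets I)).

Definition set_bits (A : {set 'I_n}) : seq bool := [seq e \in A | e <- enum 'I_n].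

(** All the rows have length [n.+1]: the unary header, then one row per set, whose prefix is the
    continuation bit of [enc_seq]. Thus the layout of the candidates is that of the encoding, and
    the closing [false] has the position of the sink. *)
Definition enc_rows : seq (seq bool) :=
  rcons (nseq n true) false :: [seq true :: set_bits A | A <- x3c_sets I].

Lemma size_set_bits A : size (set_bits A) = n.
Proof. by rewrite size_map size_enum_ord. Qed.

Lemma enc_x3cE : enc_x3c I = rcons (flatten enc_rows) false.
Proof. by rewrite /enc_x3c /enc_unary /enc_seq -rcons_cat. Qed.

Lemma size_enc_rows r : r \in enc_rows -> size r = n.+1.
Proof.
rewrite inE => /orP[/eqP ->|/mapP[A _ ->]]; first by rewrite size_rcons size_nseq.
by rewrite /= size_set_bits.
Qed.

Lemma size_enc_x3c : size (enc_x3c I) = (k.+1 * n.+1).+1.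
Proof.
by rewrite enc_x3cE size_rcons (size_flatten_uniform size_enc_rows) /= size_map.
Qed.

Definition x3c_bit (a : nat) : bool := nth false (enc_x3c I) a.

Lemma x3c_bitE j (e : 'I_n) : (j < k)%N ->
  x3c_bit (j.+1 * n.+1 + e.+1) = (e \in nth set0 (x3c_sets I) j).
Proof.
move=> jk; have en := ltn_ord e.
rewrite /x3c_bit enc_x3cE nth_rcons (size_flatten_uniform size_enc_rows).
rewrite (nth_flatten_uniform false size_enc_rows) /= ?size_map //.
rewrite (nth_map set0) //= (nth_map e) ?size_enum_ord // nth_ord_enum.
case: ltnP => // H; exfalso; move: H; rewrite leqNgt => /negP; apply.
have H : (j.+2 * n.+1 <= k.+1 * n.+1)%N by rewrite leq_mul2r ltnS jk orbT.
by move: H; rewrite !mulSn; lia.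
Qed.

Definition candidates : nat := (k.+1 * n.+1).+3.

Arguments candidates : simpl never.

Definition reduction : pw_instance :=
  level_instance (fun p a : 'I_candidates => topset n k x3c_bit p a)
    (fun p a => botset n k p a) (inord n).

Lemma x3c_big : (0 < k)%N -> (2 < n)%N.
Proof.
have := x3c_card3 I; case: (x3c_sets I) => //= A s /andP[/eqP <- _] _.
by rewrite -[leqRHS]card_ord max_card.
Qed.

(** Double counting: the multiplicities of the [n] elements are positive and sum to at most
    [3 * #|J| <= n], so all of them are [1]. *)
Lemma exact_cover_of_choice (J : {set 'I_k}) :
  (3 * #|J| <= n)%N ->
  (forall e : 'I_n, exists2 j, j \in J & e \in nth set0 (x3c_sets I) j) ->
  has_exact_cover I.
Proof.
move=> cJ cov; pose T := [set nth set0 (x3c_sets I) j | j : 'I_k in J].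
have sub : {subset T <= x3c_sets I} by move=> A /imsetP[j _ ->]; apply: mem_nth.
exists T; split=> // e.
have cov1 e' : (0 < #|[set A in T | e' \in A]|)%N.
  have [j jJ ej] := cov e'; apply/card_gt0P; exists (nth set0 (x3c_sets I) j).
  by rewrite inE ej imset_f.
have sum : (\sum_(e' : 'I_n) #|[set A in T | e' \in A]| <= n)%N.
  apply: leq_trans cJ; rewrite (eq_bigr (fun e' => \sum_(A in T) (e' \in A))%N); last first.
    move=> e' _; rewrite -sum1_card big_mkcond [RHS]big_mkcond /=.
    by apply: eq_bigr => A _; rewrite inE; case: (A \in T); case: (e' \in A).
  rewrite exchange_big /= (eq_bigr (fun=> 3%N)); last first.
    move=> A /sub AS; have /eqP <- := allP (x3c_card3 I) A AS.
    by rewrite -sum1_card [RHS]big_mkcond /=; apply: eq_bigr => e' _; case: (e' \in A).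
  by rewrite sum_nat_const mulnC leq_mul2l leq_imset_card orbT.
apply/eqP; rewrite eqn_leq cov1 andbT leqNgt; apply/negP => H.
move: sum; rewrite (bigD1 e) //=.
have : (\sum_(e' : 'I_n | e' != e) 1 <=
        \sum_(e' : 'I_n | e' != e) #|[set A in T | e' \in A]|)%N.
  by apply: leq_sum => e' _; apply: cov1.
rewrite sum1_card cardC1 card_ord => H1 H2; have := leq_trans (leq_add H H1) H2.
by have := ltn_ord e; lia.
Qed.

(** * Correctness of the reduction *)

Section Scores.

Variable alpha : seq int.
Hypotheses (size_alpha : size alpha = candidates) (alpha_sv : is_scoring_vector alpha).
Hypotheses (alpha01 : alpha`_0 > alpha`_1).
Hypotheses (alpha_mid : alpha`_1 = alpha`_(candidates.-2)).
Hypotheses (alpha_last : alpha`_(candidates.-1) = 0).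
Hypothesis alpha2 : alpha`_0 < 2 * alpha`_1.

Let firsts_lasts := possible_winner_firsts_lasts (isT : 2 < candidates)%N size_alpha
  alpha_sv alpha_mid alpha_last (inord n) (topset_top x3c_bit x3c_big)
  (@botset_bot n k x3c_bit).

Lemma reduction_sound : possible_winner alpha reduction -> has_exact_cover I.
Proof.
move=> /firsts_lasts[u [v [uv win]]].
have A0 : 0 < alpha`_0 - alpha`_1 by rewrite subr_gt0.
pose start (j : 'I_k) : 'I_candidates := inord (j.+1 * n.+1).
pose J : {set 'I_k} := [set j | pool n (u (start j))].
apply: (@exact_cover_of_choice J) => [|e].
  (* The quotients by [3] of the pool candidates are below [n %/ 3], and different rows of [J] use
     different ones. *)
  suff : (#|J| <= n %/ 3)%N by lia.
  rewrite cardE -(size_map (fun j => u (start j) %/ 3)%N) -[leqRHS](size_iota 0).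
  apply: uniq_leq_size => [|q /mapP[j]].
    rewrite map_inj_in_uniq ?enum_uniq // => j j'; rewrite !mem_enum !inE => Hj Hj' E.
    by apply/val_inj; have := pool_rows_inj uv A0 win (ltn_ord j) (ltn_ord j') Hj E Hj'.
  by rewrite mem_enum inE mem_iota /pool => /andP[? /eqP ?] ->; lia.
have [j [jk be pj]] := first_in_row uv A0 win (ltn_ord e).
by exists (Ordinal jk); rewrite ?inE // -x3c_bitE.
Qed.

Lemma reduction_complete : has_exact_cover I -> possible_winner alpha reduction.
Proof.
move=> [T [sub cov]].
pose chosen j := nth set0 (x3c_sets I) j \in T.
pose js := [seq j <- iota 0 k | chosen j].
pose rank j := index j js.
(* The defaults [set0] and [0] do not occur for [e < n], since [T] covers every element. *)
pose setof (e : nat) : nat := if insub e is Some e' then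
  index (odflt set0 [pick A in T | e' \in A]) (x3c_sets I) else 0.
have size_js : (3 * size js <= n)%N.
  have : (size js <= #|T|)%N.
    rewrite -(size_map (nth set0 (x3c_sets I))) cardE; apply: uniq_leq_size.
      rewrite map_inj_in_uniq ?filter_uniq ?iota_uniq // => i j.
      rewrite !mem_filter !mem_iota !add0n => /andP[_ /= ik] /andP[_ jk] /eqP.
      by rewrite nth_uniq ?x3c_uniq // => /eqP.
    by move=> A /mapP[j]; rewrite mem_filter mem_enum => /andP[+ _] ->.
  (* The incidences between elements and sets of [T] are counted in two ways. *)
  suff : (3 * #|T| = n)%N by lia.
  have : (\sum_(e : 'I_n) #|[set A in T | e \in A]| = n)%N.
    by rewrite (eq_bigr (fun=> 1%N)) // sum1_card card_ord.
  move=> En; apply: etrans _ En.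
  rewrite [RHS](eq_bigr (fun e => \sum_(A in T) (e \in A))%N); last first.
    move=> e _; rewrite -sum1_card big_mkcond [RHS]big_mkcond /=.
    by apply: eq_bigr => A _; rewrite inE; case: (A \in T); case: (e \in A).
  rewrite exchange_big /= [RHS](eq_bigr (fun=> 3%N)).
    by rewrite sum_nat_const mulnC.
  move=> A /sub AS; have /eqP <- := allP (x3c_card3 I) A AS.
  by rewrite -sum1_card [RHS]big_mkcond /=; apply: eq_bigr => e _; case: (e \in A).
have mem_js j : (j < k)%N -> chosen j -> j \in js.
  by move=> jk cj; rewrite mem_filter cj mem_iota.
have rank_lt j : (j < k)%N -> chosen j -> (3 * rank j + 2 < n)%N.
  move=> jk cj; have : (rank j < size js)%N by rewrite index_mem mem_js.
  by move: size_js; lia.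
have rank_inj i j : (i < k)%N -> (j < k)%N -> chosen i -> chosen j -> rank i = rank j -> i = j.
  move=> ik jk ci cj E.
  by rewrite -(nth_index 0%N (mem_js i ik ci)) -(nth_index 0%N (mem_js j jk cj)) -/(rank i) E.
have setofP e : (e < n)%N ->
    [/\ (setof e < k)%N, chosen (setof e) & x3c_bit ((setof e).+1 * n.+1 + e.+1)].
  move=> en; rewrite /setof insubT /=; case: pickP => [A /andP[AT eA]|none].
    have AS := sub A AT; have ik : (index A (x3c_sets I) < k)%N by rewrite index_mem.
    by split; rewrite /chosen ?(x3c_bitE (Ordinal en)) ?nth_index.
  have /eqP := cov (Ordinal en); rewrite eqn_leq => /andP[_ /card_gt0P[A]].
  by rewrite inE none.
pose u (p : 'I_candidates) : 'I_candidates := inord (first_nat n k chosen rank setof p).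
pose v (p : 'I_candidates) : 'I_candidates := inord (last_nat n k chosen p).
have uE (p : 'I_candidates) : u p = first_nat n k chosen rank setof p :> nat.
  by rewrite inordK //; apply: (first_nat_top rank_lt setofP (ltn_ord p)).2.
have vE (p : 'I_candidates) : v p = last_nat n k chosen p :> nat.
  by rewrite inordK //; apply: (last_nat_bot chosen (ltn_ord p)).2.
have uv (p : 'I_candidates) : [/\ topset n k x3c_bit p (u p), botset n k p (v p) & u p != v p].
  split; rewrite ?uE ?vE; [exact: (first_nat_top rank_lt setofP (ltn_ord p)).1 |
    exact: (last_nat_bot chosen (ltn_ord p)).1 |].
  by rewrite -(inj_eq val_inj) /= uE vE (first_last_neq rank_lt setofP).
apply/firsts_lasts; exists u, v; split=> // a.
rewrite (occurrences_first_dist uv) (occurrences_last_dist uv) mulr0 subr0 mulr1.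
by apply: (winner_bound rank_lt rank_inj setofP uE vE); lia.
Qed.

End Scores.

End Encoding.

(** * The machine printing the instance *)

Definition class : Type := cell * cell * cell.

Section Machine.

Local Notation tix := 'I_15.
Local Notation cells := {ffun tix -> cell}.

Definition unit_tape : tix := @Ordinal 15 1 isT.
Definition bound_p : tix := @Ordinal 15 6 isT.
Definition bound_a : tix := @Ordinal 15 9 isT.
Definition bound_b : tix := @Ordinal 15 12 isT.

(* Tapes [4,5,6], [7,8,9] and [10,11,12] hold the classes of all the positions,
   with the heads at the positions [p], [a] and [b]. Tapes [13] and [14] repeat
   the third component, with the heads at [a - p - 1] and [b - p - 1]. Tapes [2]
   and [3] have the heads at [p - a] and [p - b]. *)
Definition field (i : tix) : option (class -> cell) :=
  match val i with
  | 4 | 7 | 10 => Some (fun x => x.1.1)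
  | 5 | 8 | 11 => Some (fun x => x.1.2)
  | 6 | 9 | 12 | 13 | 14 => Some (fun x => x.2)
  | _ => None
  end.

Definition is_diff (i : tix) : bool := (val i == 2) || (val i == 3).

(** With the head at [p - a], the two marks reveal whether [a = p] or [a.+1 = p], the two relations
    used by [topset] and [botset]. *)
Definition diff_cell (j : int) : cell :=
  if j == 0 then Some true else if j == 1 then Some false else None.

Definition append (f : cells -> class) (d : move) (a : cells -> cell * move) : prog 14 :=
  Do (fun r i => if field i is Some pr then (pr (f r), MoveRight)
                 else if i == ord0 then (r i, d)
                 else if i == unit_tape then a r else keep r i).

Definition skip_unit (d : move) (r : cells) : cell * move := (r unit_tape, d).
Definition push_unit (r : cells) : cell * move := (Some true, MoveRight).

Definition reads_true (r : cells) : bool := r ord0 == Some true.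

Definition idle : prog 14 := moves (fun=> Stay).

Definition append_element (b : bool) : prog 14 :=
  append (fun=> (Some true, Some b, Some false)) MoveRight push_unit.

(** The body is unrolled three times so that the control knows the residue modulo [3], which decides
    membership in the pool. Meanwhile the unit tape receives [n] marks. *)
Definition append_elements : prog 14 :=
  While reads_true (Seq (append_element false)
    (If reads_true (Seq (append_element false)
       (If reads_true (append_element true) idle)) idle)).

Definition rewind_unit : prog 14 :=
  Seq (sweep unit_tape (only unit_tape MoveLeft)) (moves (only unit_tape MoveRight)).

(** The leading bit tells a row from the closing [false]; the marks on the unit tape measure the [n]
    bits that follow it. *)
Definition append_rows : prog 14 :=
  While reads_true
    (Seq (append (fun r => (r ord0, None, Some true)) MoveRight (skip_unit Stay))
    (Seq (While (nonblank unit_tape)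
           (append (fun r => (r ord0, None, Some false)) MoveRight (skip_unit MoveRight)))
    (Seq (moves (only unit_tape MoveLeft)) rewind_unit))).

Definition append_const (x : class) : prog 14 := append (fun=> x) Stay (skip_unit Stay).

Definition write_diff (b : bool) (d : move) : prog 14 :=
  Do (fun r i => if is_diff i then (Some b, d) else keep r i).

Definition fields_left (i : tix) : move := if field i is Some _ then MoveLeft else Stay.
(** Tapes [13] and [14] stay at [-1], the value of [a - p - 1] and [b - p - 1] at the start. *)
Definition classes_right (i : tix) : move :=
  if (4 <= val i <= 12)%N then MoveRight else Stay.

Definition setup_tapes : prog 14 :=
  Seq (write_diff true MoveRight) (Seq (write_diff false MoveLeft)
  (Seq append_elements
  (Seq (append (fun=> (Some false, Some false, Some false)) MoveRight (skip_unit MoveLeft))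
  (Seq rewind_unit
  (Seq append_rows
  (Seq (append_const (Some false, Some true, Some false))
  (Seq (append_const (Some false, Some false, Some true))
  (Seq (append_const (Some false, Some true, Some true))
  (Seq (moves fields_left) (Seq (sweep bound_p fields_left)
  (Seq (moves classes_right)
  (Seq (sweep ord0 (only ord0 MoveRight)) (moves (only ord0 MoveRight)))))))))))))).

Definition opposite (d : move) : move :=
  match d with MoveLeft => MoveRight | Stay => Stay | MoveRight => MoveLeft end.

(** After the last iteration all the heads moved by [v] are displaced by the same number of cells.
    One step back, a sweep past the left end of tape [l] and one step forward therefore restore all
    of them, those at differences included. *)
Definition loop (l : tix) (v : tix -> move) (p : prog 14) : prog 14 :=
  Seq (While (nonblank l) (Seq p (moves v)))
  (Seq (moves (opposite \o v)) (Seq (sweep l (opposite \o v)) (moves v))).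

Definition move_p (i : tix) : move :=
  match val i with
  | 2 | 3 | 4 | 5 | 6 => MoveRight | 13 | 14 => MoveLeft | _ => Stay
  end.
Definition move_a (i : tix) : move :=
  match val i with 7 | 8 | 9 | 13 => MoveRight | 2 => MoveLeft | _ => Stay end.
Definition move_b (i : tix) : move :=
  match val i with 10 | 11 | 12 | 14 => MoveRight | 3 => MoveLeft | _ => Stay end.

Definition is_element (x : class) : bool := (x.1.1 == Some true) && (x.1.2 != None).
Definition is_set (x : class) : bool := x.1.2 == None.

Definition top_test (x y : class) (d e : cell) : bool :=
  if is_element x then
    (y == (Some false, Some false, Some true)) ||
    [&& is_set y, y.1.1 == Some true & e == Some true]
  else if is_set x then
    (d == Some true) ||
    (if x.2 == Some true then (y.1.1 == Some true) && (y.1.2 == Some true)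
     else d == Some false)
  else d == Some true.

Definition bot_test (x y : class) (d : cell) : bool :=
  [|| (y == (Some false, Some true, Some false)) && (x != (Some false, Some true, Some false)),
      (d == Some true) && is_set x |
      (x == (Some false, Some true, Some false)) && (y == (Some false, Some true, Some true))].

Definition class_at (i : nat) (r : cells) : class :=
  (r (inord i), r (inord i.+1), r (inord i.+2)).

Definition vote_bit (r : cells) : bool :=
  let x := class_at 4 r in let y := class_at 7 r in let z := class_at 10 r in
  [&& ~~ bot_test x y (r (inord 2)), ~~ top_test x z (r (inord 3)) (r (inord 14))
    & top_test x y (r (inord 2)) (r (inord 13)) || bot_test x z (r (inord 3))].

Definition print_instance : prog 14 :=
  Seq (loop bound_p move_p (writes (fun=> true)))
  (Seq (writes (fun=> false))
  (Seq (loop bound_p move_p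
         (If (fun r => is_element (class_at 4 r)) (writes (fun=> true)) idle))
  (Seq (writes (fun=> false))
  (Seq (loop bound_p move_p (Seq (writes (fun=> true))
         (loop bound_a move_a (loop bound_b move_b (writes vote_bit)))))
  (Seq (writes (fun=> false)) (@finish 14)))))).

Definition reduction_program : prog 14 := Seq setup_tapes print_instance.

(** * Correctness of the machine: filling the tapes *)

Section Correctness.

(** [rest] is the input behind the encoded instance, eventually the encoding of the scoring
    vector. *)
Variables (I : x3c) (rest : seq bool).

Local Notation n := (x3c_n I).
Local Notation k := (size (x3c_sets I)).
Local Notation s := (n.+1).
Local Notation h := (k.+1 * n.+1)%N.
Local Notation m := (candidates I).
Local Notation W := (enc_x3c I ++ rest).

(* What the machine records at position [q]. On the set rows the third component
   marks the prefixes, so that [a - p - 1] carries a mark iff [a] is in the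
   column of element [p]. *)
Definition class_of (q : nat) : class :=
  if (q < n)%N then (Some true, Some (q %% 3 == 2)%N, Some false)
  else if q == n then (Some false, Some false, Some false)
  else if (q < h)%N then (Some (x3c_bit I q), None, Some (s %| q)%N)
  else if q == h then (Some false, Some true, Some false)
  else if q == h.+1 then (Some false, Some false, Some true)
  else (Some false, Some true, Some true).

Definition class_content (q : nat) (pr : class -> cell) (j : int) : cell :=
  if j is Posz i then if (i < q)%N then pr (class_of i) else None else None.

(** Invariant of the filling phase: [q] counts the recorded classes, [q0] is the input head, and [x]
    and [y] are the marks and the head of the unit tape. *)
Definition setup (q : nat) (q0 : int) (x : nat) (y : int) (t : atapes 14) : Prop :=
  [/\ forall i pr, field i = Some pr ->
        (forall j, (t i).1 j = class_content q pr j) /\ (t i).2 = q%:Z,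
      tape_at (t ord0) (map Some W) q0,
      tape_at (t unit_tape) (nseq x (Some true)) y &
      forall i, is_diff i -> (forall j, (t i).1 j = diff_cell j) /\ (t i).2 = 0].

Lemma is_diff_field i : is_diff i ->
  [/\ field i = None, i == ord0 = false & i == unit_tape = false].
Proof. by case: i => -[|[|[|[|i]]]] //=. Qed.

Lemma field_pos i pr : field i = Some pr ->
  [/\ is_diff i = false, i == ord0 = false & i == unit_tape = false].
Proof. by case: i => -[|[|[|[|i]]]] //=. Qed.

Lemma runs_append f d a q q0 x y x' y' t (Q : atapes 14 -> Prop) :
  setup q q0 x y t -> f (areads t) = class_of q ->
  tape_at (fun j => if j == (t unit_tape).2 then (a (areads t)).1 else (t unit_tape).1 j,
           (t unit_tape).2 + mvz (a (areads t)).2) (nseq x' (Some true)) y' ->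
  (forall t', setup q.+1 (q0 + mvz d) x' y' t' -> Q t') ->
  runs (append f d a) t 1 Q.
Proof.
move=> [Sf S0 S1 Sd] fq Ha HQ; apply: runs_do; apply: HQ; split.
- move=> i pr Ei; have [C1 C2] := Sf i pr Ei; rewrite /aact Ei /= C2 fq; split; last lia.
  move=> j; rewrite C1; case: j => j //=.
  case: eqP => [[->]|E]; first by rewrite ltnSn.
  by have -> : (j < q.+1)%N = (j < q)%N by lia.
- have [C1 C2] := S0; rewrite /aact /= C2; split=> //= j; rewrite ffunE C1 C2.
  by case: eqP => [->|_]; rewrite ?C1.
- exact: Ha.
- move=> i Di; have [Ei E0 E1] := is_diff_field Di; have [C1 C2] := Sd i Di.
  rewrite /aact Ei E0 E1 /= addr0; split=> // j.
  by case: eqP => [->|//]; rewrite ffunE.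
Qed.

Lemma unit_skip (t : atapes 14) x y d : tape_at (t unit_tape) (nseq x (Some true)) y ->
  tape_at (fun j => if j == (t unit_tape).2 then (skip_unit d (areads t)).1
                    else (t unit_tape).1 j,
           (t unit_tape).2 + mvz (skip_unit d (areads t)).2) (nseq x (Some true)) (y + mvz d).
Proof.
move=> [C1 C2]; split=> /= [j|]; last by rewrite C2.
by rewrite ffunE -C1; case: eqP => [->|].
Qed.

Lemma unit_push (t : atapes 14) x : tape_at (t unit_tape) (nseq x (Some true)) x%:Z ->
  tape_at (fun j => if j == (t unit_tape).2 then (push_unit (areads t)).1
                    else (t unit_tape).1 j,
           (t unit_tape).2 + mvz (push_unit (areads t)).2) (nseq x.+1 (Some true)) x.+1%:Z.
Proof.
move=> H; apply: (tape_at_eq (tape_at_write (Some true) 1 H)); last lia.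
move=> j; rewrite nth_set_nthE !nth_nseq; case: eqP => [->|E]; first by rewrite ltnSn.
by have -> : (j < x.+1)%N = (j < x)%N by lia.
Qed.

Lemma reads_input q x y t i : setup q i%:Z x y t -> (i <= h)%N ->
  areads t ord0 = Some (x3c_bit I i).
Proof.
move=> [_ [C1 C2] _ _] ih; rewrite ffunE C1 C2 /= (nth_map false).
  by rewrite nth_cat size_enc_x3c ltnS ih.
by rewrite size_cat size_enc_x3c; lia.
Qed.

Lemma x3c_bit_row r o : (r <= k)%N -> (o < s)%N ->
  x3c_bit I (r * s + o) = nth false (nth [::] (enc_rows I) r) o.
Proof.
move=> rk os; rewrite /x3c_bit enc_x3cE nth_rcons.
rewrite (size_flatten_uniform (@size_enc_rows I)) /= size_map.
rewrite (nth_flatten_uniform false (@size_enc_rows I)) /= ?size_map //.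
case: ltnP => // H; exfalso; move: H; rewrite leqNgt => /negP; apply.
have H : (r.+1 * s <= h)%N by rewrite leq_mul2r ltnS rk orbT.
by move: H; rewrite !mulSn; lia.
Qed.

Lemma x3c_bit_element q : (q < n)%N -> x3c_bit I q = true.
Proof.
move=> qn; have := @x3c_bit_row 0 q (leq0n _) (leqW qn).
by rewrite mul0n add0n => ->; rewrite /= nth_rcons size_nseq qn nth_nseq qn.
Qed.

Lemma x3c_bit_dist : x3c_bit I n = false.
Proof.
have := @x3c_bit_row 0 n (leq0n _) (ltnSn n).
by rewrite mul0n add0n => ->; rewrite /= nth_rcons size_nseq ltnn eqxx.
Qed.

Lemma x3c_bit_prefix r : (r < k)%N -> x3c_bit I (r.+1 * s) = true.
Proof.
move=> rk; have := @x3c_bit_row r.+1 0 rk (ltn0Sn n); rewrite addn0 => ->.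
by rewrite /= (nth_map set0).
Qed.

Lemma x3c_bit_end : x3c_bit I h = false.
Proof.
rewrite /x3c_bit enc_x3cE nth_rcons (size_flatten_uniform (@size_enc_rows I)) /=.
by rewrite size_map ltnn eqxx.
Qed.

Lemma reads_trueE q x y t i : setup q i%:Z x y t -> (i <= h)%N ->
  reads_true (areads t) = x3c_bit I i.
Proof. by move=> St ih; rewrite /reads_true (reads_input St ih); case: x3c_bit. Qed.

Lemma nh : (n < h)%N. Proof. by rewrite mulSn; lia. Qed.

Lemma runs_append_element b q t (Q : atapes 14 -> Prop) :
  setup q q%:Z q q%:Z t -> (q < n)%N -> b = (q %% 3 == 2)%N ->
  (forall t', setup q.+1 q.+1%:Z q.+1 q.+1%:Z t' -> Q t') ->
  runs (append_element b) t 1 Q.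
Proof.
move=> St qn -> HQ; have [_ _ S1 _] := St.
apply: (runs_append St) (unit_push S1) _; first by rewrite /class_of qn.
have -> : q%:Z + mvz MoveRight = q.+1%:Z by rewrite /=; lia.
exact: HQ.
Qed.

Lemma setup_moved v K q q0 x y t t' : setup q q0 x y t -> moved v K t t' ->
  (forall i, isSome (field i) -> v i = Stay) -> (forall i, is_diff i -> v i = Stay) ->
  setup q (q0 + mvz (v ord0) * K%:Z) x (y + mvz (v unit_tape) * K%:Z) t'.
Proof.
move=> [Sf S0 S1 Sd] Hm vf vd; split.
- move=> i pr Ei; have [C1 C2] := Sf i pr Ei; have [M1 M2] := Hm i.
  rewrite M2 C2 vf ?Ei //= mul0r addr0; split=> // j; by rewrite M1 C1.
- have [C1 C2] := S0; have [M1 M2] := Hm ord0; split=> [j|]; by rewrite ?M1 ?M2 ?C1 ?C2.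
- have [C1 C2] := S1; have [M1 M2] := Hm unit_tape; split=> [j|]; by rewrite ?M1 ?M2 ?C1 ?C2.
- move=> i Di; have [C1 C2] := Sd i Di; have [M1 M2] := Hm i.
  rewrite M2 C2 vd //= mul0r addr0; split=> // j; by rewrite M1 C1.
Qed.

Lemma runs_idle q q0 x y t (Q : atapes 14 -> Prop) : setup q q0 x y t ->
  (forall t', setup q q0 x y t' -> Q t') -> runs idle t 1 Q.
Proof.
move=> St HQ; apply: runs_moves => t' Hm; apply: HQ.
by have := setup_moved St Hm; rewrite /= !mul0r !addr0; apply.
Qed.

Lemma runs_append_elements t (Q : atapes 14 -> Prop) : setup 0 0 0 0 t ->
  (forall t', setup n n%:Z n n%:Z t' -> Q t') ->
  runs append_elements t (n * 6).+1 Q.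
Proof.
move=> S0 HQ; have nH := nh.
(* There are [n / 3] iterations, rounded up; the last one may be partial, whence [minn n (3 * i)] in
   the invariant. *)
apply: (@runs_weaken _ _ _ ((n + 2) %/ 3 * 6).+1 _ Q) => //; first lia.
pose el q := setup q q%:Z q q%:Z.
have rd q t1 : el q t1 -> (q <= n)%N -> reads_true (areads t1) = (q < n)%N.
  move=> St qn; rewrite (reads_trueE St); last by apply: leq_trans qn (ltnW nH).
  move: qn; rewrite leq_eqVlt => /orP[/eqP ->|qn]; first by rewrite x3c_bit_dist ltnn.
  by rewrite qn x3c_bit_element.
apply: (runs_weaken (leqnn _) _
    (runs_while (Inv := fun i => el (minn n (3 * i))) _ _ _)) =>
  [t1|i t1 Hi St|t1 St|].
- by rewrite (_ : minn _ _ = n); [exact: HQ | lia].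
- have i3 : (3 * i < n)%N by lia.
  rewrite (rd _ _ St) ?geq_minl //; split; first lia.
  have Em : minn n (3 * i) = (3 * i)%N by lia.
  rewrite Em in St; apply: (runs_seq (n1 := 1) (n2 := 4)).
  apply: (runs_append_element St); [by [] | lia |] => t2 S2.
  apply: runs_if; rewrite (rd _ _ S2) // => H2; last first.
    apply: (runs_weaken (n := 1) _ (fun _ H => H)) => //.
    have -> : minn n (3 * i.+1) = (3 * i).+1 by lia.
    by apply: (runs_idle S2).
  apply: (runs_seq (n1 := 1) (n2 := 2)).
  apply: (runs_append_element S2); [by [] | lia |] => t3 S3.
  apply: runs_if; rewrite (rd _ _ S3) // => H3; last first.
    have -> : minn n (3 * i.+1) = (3 * i).+2 by lia.
    by apply: (runs_idle S3).
  apply: (runs_append_element S3); [by [] | lia |].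
  by have -> : minn n (3 * i.+1) = (3 * i).+3 by lia.
- by rewrite (rd _ _ St) ?geq_minl //; lia.
- by rewrite muln0 minn0.
Qed.

Lemma runs_rewind_unit q q0 x t (Q : atapes 14 -> Prop) :
  setup q q0 x (x%:Z - 1) t -> (forall t', setup q q0 x 0 t' -> Q t') ->
  runs rewind_unit t ((x * 2).+1 + 1) Q.
Proof.
move=> St HQ; have [_ _ [C1 C2] _] := St.
apply: runs_seq; apply: runs_sweep => [i ix||t1 M1].
- rewrite C1 C2 /only eqxx /=.
  have -> : x%:Z - 1 + -1 * i%:Z = (x - i.+1)%N%:Z by lia.
  rewrite /= nth_nseq; have -> : (x - i.+1 < x)%N by lia.
  by [].
- rewrite C1 C2 /only eqxx /=.
  by have -> : x%:Z - 1 + -1 * x%:Z = -1 by lia.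
have S1 := setup_moved St M1 => {M1}.
apply: runs_moves => t2 M2.
have {}S1 : setup q q0 x (-1) t1.
  have := S1 _ _; rewrite /only /= mul0r addr0.
  have -> : x%:Z - 1 + -1 * x%:Z = -1 by lia.
  by apply=> i; [case: eqP => // -> | case: eqP => // ->].
have := setup_moved S1 M2; rewrite /only /= mul0r addr0 => S2; apply: HQ; apply: S2.
  by move=> i; case: eqP => // ->.
by move=> i; case: eqP => // ->.
Qed.

Lemma class_of_row r o : (r < k)%N -> (o < s)%N ->
  class_of (r.+1 * s + o) = (Some (x3c_bit I (r.+1 * s + o)), None, Some (o == 0)%N).
Proof.
move=> rk os; have [sp _ dp] := set_pos_intro rk os.
rewrite /class_of dp; move: sp; rewrite /set_pos => /andP[H1 ->].
by rewrite ltnNge (ltnW H1) /= (gtn_eqF H1).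
Qed.

Lemma set_pos_le r o : (r < k)%N -> (o < s)%N -> (r.+1 * s + o < h)%N.
Proof. by move=> rk os; have [/andP[]] := set_pos_intro rk os. Qed.

Lemma runs_append_rows t (Q : atapes 14 -> Prop) : setup s s%:Z n 0 t ->
  (forall t', setup h h%:Z n 0 t' -> Q t') ->
  runs append_rows t
    (k * (1 + ((n * 2).+1 + (1 + ((n * 2).+1 + 1)))).+1).+1 Q.
Proof.
move=> S0 HQ.
apply: (runs_weaken (leqnn _) _
    (runs_while (Inv := fun r => setup (r.+1 * s) (r.+1 * s)%N%:Z n 0) _ _ _)) =>
  [//|r t1 rk St|t1 St|].
- have rh := ltnW (set_pos_le rk (ltn0Sn n)); rewrite addn0 in rh.
  split; first by rewrite (reads_trueE St rh) x3c_bit_prefix.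
  have [_ _ U1 _] := St.
  apply: runs_seq; apply: (runs_append St) (unit_skip _ U1) _.
    by rewrite (reads_input St rh) -[(r.+1 * s)%N]addn0 class_of_row.
  rewrite /= addr0 => t2 S2; apply: runs_seq.
  pose Inv o t' := setup (r.+1 * s + o.+1) (r.+1 * s + o.+1)%N%:Z n o%:Z t'.
  apply: (runs_weaken (leqnn _) _ (runs_while (n := 1) (Inv := Inv) _ _ _)) =>
    [t3 S3|o t3 on S3|t3 S3|].
  + apply: runs_seq; apply: runs_moves => t4 M4.
    have S4 : setup (r.+2 * s) (r.+2 * s)%N%:Z n (n%:Z - 1) t4.
      have := setup_moved S3 M4; rewrite /only /= mul0r addr0.
      have -> : n%:Z + -1 * 1 = n%:Z - 1 by lia.
      have -> : (r.+1 * s + s = r.+2 * s)%N by rewrite [RHS]mulSn addnC.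
      by apply=> i; case: eqP => // ->.
    exact: (runs_rewind_unit S4).
  + have oh := ltnW (set_pos_le rk (on : (o.+1 < s)%N)).
    have [_ _ U3 _] := S3; split.
      have [C1 C2] := U3.
      by rewrite /nonblank ffunE C1 C2 /= nth_nseq on.
    apply: (runs_append S3) (unit_skip _ U3) _.
      by rewrite (reads_input S3 oh) class_of_row.
    move=> t4; rewrite /Inv.
    have <- : (r.+1 * s + o.+1).+1 = (r.+1 * s + o.+2)%N by rewrite -addnS.
    have -> : (r.+1 * s + o.+1)%N%:Z + mvz MoveRight = (r.+1 * s + o.+1).+1%:Z.
      by rewrite /=; lia.
    by have -> : o%:Z + mvz MoveRight = o.+1%:Z by rewrite /=; lia.
  + have [_ _ [C1 C2] _] := S3.
    by rewrite /nonblank ffunE C1 C2 /= nth_nseq ltnn.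
  + rewrite /Inv addn1.
    by have <- : (r.+1 * s)%N%:Z + 1 = (r.+1 * s).+1%:Z by lia.
- by rewrite (reads_trueE St) // x3c_bit_end.
- by rewrite mul1n.
Qed.

(** * Tape contents and heads during the printing loops *)

Definition base : int := (size W).+1%:Z.

Definition fixed_content (i : tix) : int -> cell :=
  if field i is Some pr then class_content m pr else diff_cell.

(** While printing, only tape [0] changes its contents; nothing is asserted about the unit tape any
    more. *)
Definition main (H : tix -> int) (out : seq bool) (t : atapes 14) : Prop :=
  (forall i : tix, (1 < i)%N -> (forall j, (t i).1 j = fixed_content i j) /\ (t i).2 = H i) /\
  written base out t.

Definition heads (p a b : int) (i : tix) : int :=
  match val i with
  | 2 => p - a | 3 => p - b
  | 4 | 5 | 6 => p | 7 | 8 | 9 => a | 10 | 11 | 12 => b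
  | 13 => a - p - 1 | 14 => b - p - 1
  | _ => 0
  end.

(** On set rows the second component is blank. The third never is, so its tapes can delimit the
    sweeps and loops. *)
Lemma class_of_snd q : (class_of q).2 <> None.
Proof. by rewrite /class_of; do ![case: ifP => // _]. Qed.

Lemma diff_or_field (i : tix) : (1 < i)%N -> field i = None -> is_diff i.
Proof.
by case: i => -[|[|[|[|i]]]] //= ii _; do 11![case: i ii => [|i] ii //].
Qed.

Definition setup_time (n' k' m' l : nat) : nat :=
  1 + (1 + ((n' * 6).+1 + (1 + (((n' * 2).+1 + 1) +
  ((k' * (1 + ((n' * 2).+1 + (1 + ((n' * 2).+1 + 1)))).+1).+1 +
  (1 + (1 + (1 + (1 + ((m' * 2).+1 + (1 + ((l * 2).+1 + 1)))))))))))).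

Lemma runs_setup_tapes (Q : atapes 14 -> Prop) :
  (forall t, main (heads 0 0 0) [::] t -> Q t) ->
  runs setup_tapes (@ainit 14 W) (setup_time n k m (size W - h)) Q.
Proof.
move=> HQ; have nH := nh.
apply: runs_seq; apply: runs_do; set t00 := aact _ _.
apply: runs_seq; apply: runs_do; set t0 := aact _ _.
have keep0 i : is_diff i = false ->
    (forall j, (t0 i).1 j = (@ainit 14 W i).1 j) /\ (t0 i).2 = (@ainit 14 W i).2.
  move=> Di; have [|A1 A2] := @aact_keep 14 i
    (fun i => if is_diff i then (Some false, MoveLeft) else keep (areads t00) i) t00.
    by rewrite Di.
  have [|A3 A4] := @aact_keep 14 i (fun i => if is_diff i then (Some true, MoveRight)
    else keep (areads (@ainit 14 W)) i) (@ainit 14 W); first by rewrite Di.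
  by split=> [j|]; rewrite ?A1 ?A3 ?A2 ?A4.
have S0 : setup 0 0 0 0 t0.
  split.
  - move=> i pr Ei; have [D0 E0 E1] := field_pos Ei; have [A1 A2] := keep0 i D0.
    by rewrite A2 /ainit; split=> // j; rewrite A1 /ainit E0 /=; case: j.
  - have [A1 A2] := keep0 ord0 erefl; split=> // j; rewrite A1 /=; by case: j.
  - have [A1 A2] := keep0 unit_tape erefl; split=> // j.
    by rewrite A1 /=; case: j => [j|j] //=; rewrite nth_nil.
  - move=> i Di; have [Ei E0 E1] := is_diff_field Di.
    rewrite /t0 /aact Di /t00 /aact Di /ainit E0 /=; split=> // j.
    by rewrite /diff_cell; case: eqP => [->|_] //; case: eqP.
clearbody t0; apply: runs_seq; apply: (runs_append_elements S0) => t1 S1.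
apply: runs_seq; have [_ _ U1 _] := S1.
apply: (runs_append S1) (unit_skip _ U1) _.
  by rewrite /class_of ltnn eqxx.
have -> : n%:Z + mvz MoveRight = s%:Z by rewrite /=; lia.
move=> t2 S2; apply: runs_seq; apply: (runs_rewind_unit S2) => t3 S3.
apply: runs_seq; apply: (runs_append_rows S3) => t4 S4.
apply: runs_seq; have [_ _ U4 _] := S4.
apply: (runs_append S4) (unit_skip _ U4) _.
  by rewrite /class_of ltnn eqxx ltnNge (ltnW nH) /= (gtn_eqF nH).
rewrite /= !addr0 => t5 S5; apply: runs_seq; have [_ _ U5 _] := S5.
apply: (runs_append S5) (unit_skip _ U5) _.
  rewrite /class_of eqxx; have -> : (h.+1 < n)%N = false by lia.
  have -> : (h.+1 == n) = false by lia.
  have -> : (h.+1 < h)%N = false by lia.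
  by have -> : (h.+1 == h) = false by lia.
rewrite /= !addr0 => t6 S6; apply: runs_seq; have [_ _ U6 _] := S6.
apply: (runs_append S6) (unit_skip _ U6) _.
  rewrite /class_of; have -> : (h.+2 < n)%N = false by lia.
  have -> : (h.+2 == n) = false by lia.
  have -> : (h.+2 < h)%N = false by lia.
  have -> : (h.+2 == h) = false by lia.
  by have -> : (h.+2 == h.+1) = false by lia.
rewrite /= !addr0 => t7 [Sf S00 _ Sd].
apply: runs_seq; apply: runs_moves => t8 M8.
have [P1 P2] := Sf bound_p _ erefl; have [P3 P4] := M8 bound_p.
apply: runs_seq; apply: (@runs_sweep _ _ _ m) => [i im||t9 M9].
- rewrite P3 P4 P1 P2 /= -/(candidates I).
  have -> : (candidates I)%:Z + -1 * 1%:Z + -1 * i%:Z = (m - i.+1)%N%:Z by lia.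
  rewrite /= (_ : (m - i.+1 < m)%N); first exact: class_of_snd.
  by lia.
- rewrite P3 P4 P1 P2 /= -/(candidates I).
  by have -> : (candidates I)%:Z + -1 * 1%:Z + -1 * m%:Z = -1 by lia.
apply: runs_seq; apply: runs_moves => t10 M10.
have [Z1 Z2] := S00; have [Z3 Z4] := M8 ord0; have [Z5 Z6] := M9 ord0.
have [Z7 Z8] := M10 ord0.
have Zc j : (t10 ord0).1 j = seq_content (map Some W) j by rewrite Z7 Z5 Z3.
have Zh : (t10 ord0).2 = h by rewrite Z8 Z6 Z4 Z2 /=; lia.
have hW : (h < size W)%N by rewrite size_cat size_enc_x3c; lia.
apply: runs_seq; apply: (@runs_sweep _ _ _ (size W - h)) => [i im||t11 M11].
- rewrite Zc Zh /only eqxx /mvz.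
  have -> : h%:Z + 1 * i%:Z = (h + i)%N%:Z by lia.
  by rewrite /= (nth_map false) //; lia.
- rewrite Zc Zh /only eqxx /mvz.
  have -> : h%:Z + 1 * (size W - h)%N%:Z = (size W)%:Z by lia.
  by rewrite /= nth_default // size_map.
apply: runs_moves => t12 M12; apply: HQ.
have [Z9 Z10] := M11 ord0; have [Z11 Z12] := M12 ord0.
have {}Zc j : (t12 ord0).1 j = seq_content (map Some W) j by rewrite Z11 Z9 Zc.
split; last first.
  split.
  - by rewrite Z12 Z10 Zh /only eqxx /= /base; lia.
  - rewrite Zc /base (_ : _ - 1 = (size W)%:Z); last lia.
    by rewrite /= nth_default // size_map.
  - move=> j; rewrite Zc /base (_ : _ + _ = (size W + j.+1)%N%:Z); last lia.
    by rewrite /= nth_nil nth_default // size_map leq_addr.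
move=> i i1; have [A1 A2] := M8 i; have [A3 A4] := M9 i; have [A5 A6] := M10 i.
have [A7 A8] := M11 i; have [A9 A10] := M12 i.
have i0 : (i == ord0) = false by apply/eqP => E; rewrite E in i1.
rewrite A10 A8 A6 A4 A2 /only i0 /= !mul0r !addr0 /fixed_content /fields_left.
case Ei: (field i) => [pr|].
  have [B1 B2] := Sf i pr Ei; split=> [j|]; first by rewrite A9 A7 A5 A3 A1 B1.
  rewrite B2 -/(candidates I); move: Ei i1; rewrite /field /classes_right /heads.
  case: i {i0 A1 A2 A3 A4 A5 A6 A7 A8 A9 A10 B1 B2} => -[|[|[|[|i]]]] //= ii.
  by do 11![case: i ii => [|i] ii /=; first by move=> _ _; lia].
have Di := diff_or_field i1 Ei; have [B1 B2] := Sd i Di.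
split=> [j|]; first by rewrite A9 A7 A5 A3 A1 B1.
rewrite B2; move: Di; rewrite /is_diff /classes_right /heads.
by case/orP => /eqP ->.
Qed.

Lemma main_moved v K H out t t' : main H out t -> moved v K t t' -> v ord0 = Stay ->
  main (fun i => H i + mvz (v i) * K%:Z) out t'.
Proof.
move=> [HM [W1 W2 W3]] M v0; split=> [i i1|].
  have [C1 C2] := HM i i1; have [M1 M2] := M i.
  by rewrite M2 C2; split=> // j; rewrite M1 C1.
have [M1 M2] := M ord0; split=> [||j]; rewrite ?M1 // M2 W1 v0 /= mul0r addr0 //.
Qed.

Lemma main_ext H H' out t : main H out t -> H =1 H' -> main H' out t.
Proof. by move=> [HM HW] E; split=> // i /HM; rewrite E. Qed.

Lemma main_read H out t (i : tix) : main H out t -> (1 < i)%N ->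
  areads t i = fixed_content i (H i).
Proof. by move=> [HM _] /HM[C1 C2]; rewrite ffunE C1 C2. Qed.

Lemma runs_print b H out t : main H out t ->
  runs (writes b) t 1 (main H (rcons out (b (areads t)))).
Proof.
move=> [HM HW]; apply: (runs_writes HW) => t' W' F; split=> // i i1.
have [|F1 F2] := F i; first by apply/eqP => E; rewrite E in i1.
by rewrite F2; have [C1 C2] := HM i i1; split=> // j; rewrite F1 C1.
Qed.

Definition loop_time (K t : nat) : nat := (K * (t + 1).+1).+1 + (1 + ((K * 2).+1 + 1)).

Lemma mvz_opposite d : mvz (opposite d) = - mvz d.
Proof. by case: d. Qed.

Lemma runs_loop l v body T (o : nat -> seq bool) H out t :
  v l = MoveRight -> v ord0 = Stay -> (1 < l)%N -> H l = 0 ->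
  fixed_content l =1 class_content m snd ->
  (forall i out' t', (i < m)%N -> main (fun x => H x + mvz (v x) * i%:Z) out' t' ->
     runs body t' T (main (fun x => H x + mvz (v x) * i%:Z) (out' ++ o i))) ->
  main H out t ->
  runs (loop l v body) t (loop_time m T) (main H (out ++ flatten (mkseq o m))).
Proof.
move=> vl v0 l1 Hl fl Hbody Ht.
pose Inv i := main (fun x => H x + mvz (v x) * i%:Z) (out ++ flatten (mkseq o i)).
have rd i t' : Inv i t' -> areads t' l = class_content m snd i%:Z.
  by move=> H'; rewrite (main_read H' l1) Hl vl add0r mul1r fl.
apply: runs_seq; apply: (runs_weaken (leqnn _) _ (runs_while (Inv := Inv) _ _ _)) =>
  [t1 Ht1|i t1 im Ht1|t1 Ht1|].
- apply: runs_seq; apply: runs_moves => t2 M2.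
  have H2 := main_moved Ht1 M2; rewrite /= v0 in H2; have {}H2 := H2 erefl.
  have [H2f _] := H2; have [C1 C2] := H2f l l1.
  apply: runs_seq; apply: (@runs_sweep _ _ _ m) => [i im||t3 M3].
  + rewrite C1 C2 fl Hl /= vl add0r mul1r.
    have -> : (candidates I)%:Z + -1 * 1%:Z + -1 * i%:Z = (m - i.+1)%N%:Z by lia.
    rewrite /= (_ : (m - i.+1 < m)%N); first exact: class_of_snd.
    by rewrite /candidates; lia.
  + rewrite C1 C2 fl Hl /= vl add0r mul1r.
    by have -> : (candidates I)%:Z + -1 * 1%:Z + -1 * (candidates I)%:Z = -1 by lia.
  + have H3 := main_moved H2 M3; rewrite /= v0 in H3; have {}H3 := H3 erefl.
    apply: runs_moves => t4 M4; apply: (main_ext (main_moved H3 M4 v0)) => x.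
    by rewrite /= mvz_opposite; lia.
- split; first by rewrite /nonblank (rd _ _ Ht1) /= im; apply/eqP; apply: class_of_snd.
  apply: runs_seq; apply: runs_weaken (Hbody i _ t1 im Ht1) => [//|t2 H2].
  apply: runs_moves => t3 M3; rewrite /Inv mkseqS /= flatten_rcons catA.
  by apply: (main_ext (main_moved H2 M3 v0)) => x; lia.
- by rewrite /nonblank (rd _ _ Ht1) /= ltnn.
- by rewrite /Inv /= cats0; apply: main_ext Ht _ => x; rewrite mulr0 addr0.
Qed.

(** * Recognizing the votes from the recorded classes *)

Lemma is_elementE q : is_element (class_of q) = (q < n)%N.
Proof.
rewrite /class_of /is_element; case: ltnP => // _.
by do ![case: ifP => //= _]; rewrite andbF.
Qed.

Lemma is_setE q : is_set (class_of q) = set_pos n k q.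
Proof.
rewrite /class_of /is_set /set_pos; case: (ltngtP q n) => [//|nq|//].
by case: ltnP => //= _; do ![case: ifP => // _].
Qed.

Lemma class_of_set q : set_pos n k q ->
  class_of q = (Some (x3c_bit I q), None, Some (s %| q)%N).
Proof.
move=> /andP[nq qh]; rewrite /class_of qh.
by rewrite ltnNge (ltnW nq) /= (gtn_eqF nq).
Qed.

Lemma class_of_top q : (class_of q == (Some false, Some false, Some true)) = (q == h.+1).
Proof.
have nH := nh; rewrite /class_of; case: ltnP => qn.
  by have -> : (q == h.+1) = false by lia.
case: (eqVneq q n) => qn2; first by have -> : (q == h.+1) = false by lia.
case: ltnP => qh.
  have -> : (q == h.+1) = false by lia.
  by rewrite !xpair_eqE /= andbF.
case: (eqVneq q h) => qh2; first by have -> : (q == h.+1) = false by lia.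
by case: (q == h.+1).
Qed.

Lemma class_of_bot q : (class_of q == (Some false, Some true, Some false)) = (q == h).
Proof.
have nH := nh; rewrite /class_of; case: ltnP => qn.
  by have -> : (q == h) = false by lia.
case: (eqVneq q n) => qn2; first by have -> : (q == h) = false by lia.
case: ltnP => qh.
  have -> : (q == h) = false by lia.
  by rewrite !xpair_eqE /= andbF.
by case: (eqVneq q h) => qh2; last case: (q == h.+1).
Qed.

Lemma class_of_last q : (q < m)%N ->
  (class_of q == (Some false, Some true, Some true)) = (q == h.+2).
Proof.
have nH := nh; rewrite /candidates /class_of => qm.
case: ltnP => qn; first by have -> : (q == h.+2) = false by lia.
case: (eqVneq q n) => qn2; first by have -> : (q == h.+2) = false by lia.
case: ltnP => qh.
  have -> : (q == h.+2) = false by lia.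
  by rewrite !xpair_eqE /= andbF.
case: (eqVneq q h) => qh2; first by have -> : (q == h.+2) = false by lia.
case: (eqVneq q h.+1) => qh3; first by have -> : (q == h.+2) = false by lia.
by have -> : (q == h.+2) by lia.
Qed.

Lemma class_of_pool q :
  ((class_of q).1.1 == Some true) && ((class_of q).1.2 == Some true) = pool n q.
Proof.
rewrite /class_of /pool; case: ltnP => _ /=; first by case: (_ == 2).
by do ![case: ifP => //= _]; rewrite andbF.
Qed.

Lemma diff_cell_eq (p a : nat) : (diff_cell (p%:Z - a%:Z) == Some true) = (a == p).
Proof.
rewrite /diff_cell; have -> : (p%:Z - a%:Z == 0) = (a == p) by lia.
by case: (a == p) => //; case: (_ == 1).
Qed.

Lemma diff_cell_succ (p a : nat) :
  (diff_cell (p%:Z - a%:Z) == Some false) = (a.+1 == p).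
Proof.
rewrite /diff_cell; have -> : (p%:Z - a%:Z == 1) = (a.+1 == p) by lia.
case: (eqVneq a.+1 p) => [<-|_]; last by case: (_ == 0).
by have -> : (a.+1%:Z - a%:Z == 0) = false by lia.
Qed.

(** Since [p < n < a], the offset [a - p - 1] is positive. Offsets up to [n] carry no mark and are
    not multiples of [s]; on larger ones the marks are the prefixes. *)
Lemma column_cell (p a : nat) : (p < n)%N -> set_pos n k a ->
  (class_content m snd (a%:Z - p%:Z - 1) == Some true) = (s %| a - p.+1)%N.
Proof.
move=> pn /andP[na ah].
have -> : a%:Z - p%:Z - 1 = (a - p.+1)%N%:Z by lia.
have im : (a - p.+1 < m)%N by rewrite /candidates; lia.
rewrite /= im; set i := (a - p.+1)%N.
have [iN|Ni] := leqP i n.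
  have i0 : (0 < i)%N by rewrite /i; lia.
  have -> : (s %| i)%N = false by rewrite /dvdn modn_small ?ltnS // gtn_eqF.
  rewrite /class_of; case: ltnP => // H.
  by have -> : i == n by apply/eqP; lia.
by rewrite class_of_set /set_pos ?Ni /=; [case: (_ %| _)%N | rewrite /i; lia].
Qed.

Lemma top_testE (p a : nat) : (p < m)%N -> (a < m)%N ->
  top_test (class_of p) (class_of a) (diff_cell (p%:Z - a%:Z))
    (class_content m snd (a%:Z - p%:Z - 1)) = topset n k (x3c_bit I) p a.
Proof.
move=> pm am; rewrite /top_test /topset is_elementE class_of_top !is_setE.
case: ltnP => pn.
  have [sa|//] := boolP (set_pos n k a).
  by rewrite column_cell // class_of_set //=; case: (x3c_bit I a).
rewrite !diff_cell_eq diff_cell_succ class_of_pool.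
have [sp|//] := boolP (set_pos n k p).
by rewrite class_of_set //=; case: (_ %| _)%N.
Qed.

Lemma bot_testE (p a : nat) : (p < m)%N -> (a < m)%N ->
  bot_test (class_of p) (class_of a) (diff_cell (p%:Z - a%:Z)) = botset n k p a.
Proof.
by move=> pm am; rewrite /bot_test /botset !class_of_bot class_of_last // diff_cell_eq is_setE.
Qed.

Definition level_bit (p a b : nat) : bool :=
  [&& ~~ botset n k p a, ~~ topset n k (x3c_bit I) p b
    & topset n k (x3c_bit I) p a || botset n k p b].

Lemma class_at_p p a b out t : (p < m)%N -> main (heads p%:Z a b) out t ->
  class_at 4 (areads t) = class_of p.
Proof.
move=> pm Ht; rewrite /class_at !(main_read Ht) ?inordK //.
by rewrite /fixed_content /field /heads /= !inordK //= pm; case: (class_of p) => -[].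
Qed.

Lemma vote_bitE p a b out t : (p < m)%N -> (a < m)%N -> (b < m)%N ->
  main (heads p%:Z a%:Z b%:Z) out t -> vote_bit (areads t) = level_bit p a b.
Proof.
move=> pm am bm Ht; rewrite /vote_bit (class_at_p pm Ht).
have -> : class_at 7 (areads t) = class_of a.
  rewrite /class_at !(main_read Ht) ?inordK //.
  by rewrite /fixed_content /field /heads /= !inordK //= am; case: (class_of a) => -[].
have -> : class_at 10 (areads t) = class_of b.
  rewrite /class_at !(main_read Ht) ?inordK //.
  by rewrite /fixed_content /field /heads /= !inordK //= bm; case: (class_of b) => -[].
rewrite !(main_read Ht) ?inordK // /fixed_content /field /heads /= !inordK //=.
by rewrite !top_testE ?bot_testE.
Qed.

Lemma heads_move_p p a b (i : int) :
  (fun x => heads p a b x + mvz (move_p x) * i) =1 heads (p + i) a b.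
Proof. by case=> x xl; rewrite /heads /move_p /=; do 15![case: x xl => [|x] xl /=; first lia]. Qed.

Lemma heads_move_a p a b (i : int) :
  (fun x => heads p a b x + mvz (move_a x) * i) =1 heads p (a + i) b.
Proof. by case=> x xl; rewrite /heads /move_a /=; do 15![case: x xl => [|x] xl /=; first lia]. Qed.

Lemma heads_move_b p a b (i : int) :
  (fun x => heads p a b x + mvz (move_b x) * i) =1 heads p a (b + i).
Proof. by case=> x xl; rewrite /heads /move_b /=; do 15![case: x xl => [|x] xl /=; first lia]. Qed.

(** * Printing the instance *)

Definition vote_output (p : nat) : seq bool :=
  flatten (mkseq (fun a => flatten (mkseq (fun b => [:: level_bit p a b]) m)) m).

Lemma runs_print_vote p out t : (p < m)%N -> main (heads p%:Z 0 0) out t ->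
  runs (loop bound_a move_a (loop bound_b move_b (writes vote_bit))) t
    (loop_time m (loop_time m 1)) (main (heads p%:Z 0 0) (out ++ vote_output p)).
Proof.
move=> pm; apply: runs_loop => // a out1 t1 am Ht1.
have {}Ht1 := main_ext Ht1 (@heads_move_a _ _ _ _); rewrite add0r in Ht1.
apply: (runs_weaken (leqnn _) (fun _ H => main_ext H (fsym (@heads_move_a _ _ _ _)))).
rewrite add0r; move: Ht1; apply: runs_loop => // b out2 t2 bm Ht2.
have {}Ht2 := main_ext Ht2 (@heads_move_b _ _ _ _); rewrite add0r in Ht2.
apply: (runs_weaken (leqnn _) (fun _ H => main_ext H (fsym (@heads_move_b _ _ _ _)))).
rewrite add0r cats1 -(vote_bitE pm am bm Ht2); exact: runs_print.
Qed.

Definition instance_output : seq bool :=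
  rcons (nseq m true) false ++ rcons (nseq n true) false ++
  rcons (flatten (mkseq (fun p => true :: vote_output p) m)) false.

Lemma size_flatten_mkseq (T : eqType) (F : nat -> seq T) l q :
  (forall i, size (F i) = l) -> size (flatten (mkseq F q)) = (q * l)%N.
Proof.
move=> H; rewrite (@size_flatten_uniform _ _ l) ?size_mkseq // => r /mapP[i _ ->].
exact: H.
Qed.

Lemma size_vote_output p : size (vote_output p) = (m * m)%N.
Proof.
apply: size_flatten_mkseq => a.
by rewrite (@size_flatten_mkseq _ _ 1) ?muln1.
Qed.

Lemma size_instance_output :
  size instance_output = (m + n + m * (m * m).+1 + 3)%N.
Proof.
rewrite /instance_output !size_cat !size_rcons !size_nseq.
rewrite (@size_flatten_mkseq _ _ (m * m).+1); first lia.
by move=> p; rewrite -(size_vote_output p).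
Qed.

Definition print_time (n' m' : nat) : nat :=
  loop_time m' 1 + (1 + (loop_time m' 2 + (1 +
  (loop_time m' (1 + loop_time m' (loop_time m' 1)) +
  (1 + ((m' + n' + m' * (m' * m').+1 + 3) * 2 + 3)))))).

Lemma flatten_nseq1 (T : Type) (x : T) q : flatten (mkseq (fun=> [:: x]) q) = nseq q x.
Proof. by rewrite /mkseq; elim: q 0%N => //= q IH i; rewrite IH. Qed.

(** The distinguished candidate is printed in unary by a loop over all the positions that prints one
    bit at each element. *)
Lemma flatten_prefix1 (T : Type) (x : T) q r : (q <= r)%N ->
  flatten (mkseq (fun i => if (i < q)%N then [:: x] else [::]) r) = nseq q x.
Proof.
move=> /subnKC <-; elim: (r - q)%N => [|d IH].
  rewrite addn0 -flatten_nseq1; congr flatten; apply/eq_in_map => i.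
  by rewrite mem_iota add0n /= => ->.
by rewrite addnS mkseqS flatten_rcons IH ltnNge leq_addr cats0.
Qed.

Lemma runs_print_instance t : main (heads 0 0 0) [::] t ->
  runs print_instance t (print_time n m) (shows instance_output).
Proof.
move=> H0; apply: runs_seq.
apply: (runs_weaken (leqnn _) _ (runs_loop (o := fun=> [:: true]) _ _ _ _ _ _ H0)) => //;
  last by move=> i out t' im; rewrite cats1; apply: runs_print.
move=> t1; rewrite flatten_nseq1 => H1; apply: runs_seq.
apply: runs_weaken (runs_print (fun=> false) H1) => // t2 H2; apply: runs_seq.
apply: (runs_weaken (leqnn _) _ (runs_loop
    (o := fun i => if (i < n)%N then [:: true] else [::]) _ _ _ _ _ _ H2)) => //; last first.
  move=> i out t' im Ht'.
  have E : is_element (class_at 4 (areads t')) = (i < n)%N.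
    have H' := main_ext Ht' (@heads_move_p _ _ _ _); rewrite add0r in H'.
    by rewrite (class_at_p im H') is_elementE.
  apply: runs_if; rewrite E => Hi; first by rewrite Hi cats1; apply: runs_print.
  rewrite (negbTE Hi) cats0; apply: runs_moves => t'' M.
  by apply: (main_ext (main_moved Ht' M erefl)) => x; rewrite mul0r addr0.
move=> t3; rewrite flatten_prefix1; last by have := nh; rewrite /candidates; lia.
move=> H3; apply: runs_seq.
apply: runs_weaken (runs_print (fun=> false) H3) => // t4 H4; apply: runs_seq.
apply: (runs_weaken (leqnn _) _ (runs_loop
    (o := fun p => true :: vote_output p) _ _ _ _ _ _ H4)) => //; last first.
  move=> p out t' pm Ht'.
  have {}Ht' := main_ext Ht' (@heads_move_p _ _ _ _); rewrite add0r in Ht'.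
  apply: (runs_weaken (leqnn _) (fun _ H => main_ext H (fsym (@heads_move_p _ _ _ _)))).
  rewrite add0r; apply: runs_seq.
  apply: runs_weaken (runs_print (fun=> true) Ht') => // t'' H''.
  by rewrite -cat_rcons; apply: runs_print_vote.
move=> t5 H5; apply: runs_seq.
apply: runs_weaken (runs_print (fun=> false) H5) => // t6 [_ H6].
rewrite -size_instance_output muln2; apply: (@runs_finish _ base).
by move: H6; rewrite /instance_output cat0s !rcons_cat -catA.
Qed.

Lemma map_enum_ord (T : Type) (F : nat -> T) q : [seq F (val a) | a <- enum 'I_q] = mkseq F q.
Proof. by rewrite /mkseq -val_enum_ord -map_comp. Qed.

Lemma enc_pw_reduction : enc_pw (reduction I) = instance_output.
Proof.
have nm : (n < m)%N by have := nh; rewrite /candidates; lia.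
have dE : pw_dist (reduction I) = n :> nat by apply: inordK.
rewrite /enc_pw dE /enc_unary /instance_output /enc_seq.
congr (_ ++ (_ ++ (rcons (flatten _) _))); rewrite /level_profile -map_comp -map_enum_ord.
apply: eq_map => p /=; congr (_ :: _).
rewrite /enc_vote /vote_output -map_enum_ord; congr flatten; apply: eq_map => a.
rewrite flatten_map1 -[RHS]/(mkseq (level_bit p a) m) -map_enum_ord; apply: eq_map => b.
by rewrite level_voteE.
Qed.

Lemma runs_reduction_program : runs reduction_program (@ainit 14 W)
  (setup_time (size W) (size W) (size W + 2) (size W) + print_time (size W) (size W + 2))
  (shows (enc_pw (reduction I))).
Proof.
have nH := nh; have hW : (h < size W)%N by rewrite size_cat size_enc_x3c; lia.
have kh : (k <= h)%N by rewrite mulnS; lia.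
have [nW kW] : (n <= size W)%N /\ (k <= size W)%N by lia.
have mW : (m <= size W + 2)%N by rewrite /candidates; lia.
have lW : (size W - h <= size W)%N by exact: leq_subr.
apply: (@runs_weaken _ _ _ (setup_time n k m (size W - h) + print_time n m) _
    (shows (enc_pw (reduction I)))) => //.
  (* Both times are monotone in all parameters, which are replaced by bounds in terms of the input
     length alone. *)
  move: (size W) (size W - h)%N nW kW mW lW => l l' nW kW mW lW.
  rewrite /setup_time /print_time /loop_time.
  by do ![apply: leq_add | rewrite ltnS | apply: leq_mul].
apply: runs_seq; apply: runs_setup_tapes => t Ht.
by rewrite enc_pw_reduction; apply: runs_print_instance.
Qed.

End Correctness.

End Machine.

Lemma poly_time_reduction (A : Type) (encA : A -> seq bool) :
  poly_time (enc_pair enc_x3c encA) enc_pw (fun x => reduction x.1).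
Proof.
apply: (poly_time_runs (p := reduction_program)
  (T := fun l => setup_time l l (l + 2) l + print_time l (l + 2))%N).
  rewrite /setup_time /print_time /loop_time.
  do !first [apply: poly_bounded_id | apply: poly_bounded_const
    | apply: poly_bounded_succ | apply: poly_bounded_add | apply: poly_bounded_mul].
by move=> [I a]; apply: runs_reduction_program.
Qed.

Theorem theorem3 :
  exists f : x3c -> nat,
  [/\ poly_time enc_x3c enc_nat f,
      exists p : {poly nat},
        forall I : x3c, (f I <= p.[size (enc_x3c I)])%N,
      forall I : x3c, (0 < f I)%N &
      exists2 g : x3c * seq int -> pw_instance,
        poly_time (enc_pair enc_x3c (enc_seq enc_int)) enc_pw g &
        forall (I : x3c) (alpha : seq int),
          size alpha = (f I).+2 ->
          is_scoring_vector alpha ->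
          alpha`_0 > alpha`_1 ->
          alpha`_1 = alpha`_(f I) ->
          alpha`_(f I) > alpha`_(f I).+1 ->
          alpha`_(f I).+1 = 0 ->
          alpha`_0 < 2 * alpha`_1 ->
          pw_m (g (I, alpha)) = (f I).+2 /\
          (possible_winner alpha (g (I, alpha)) <-> has_exact_cover I)].
Proof.
exists (fun I => size (enc_x3c I)); split.
- exact: poly_time_size.
- by exists 'X => I; rewrite hornerX.
- by move=> I; rewrite size_enc_x3c.
exists (fun x => reduction x.1); first exact: poly_time_reduction.
move=> I alpha; rewrite size_enc_x3c => sz sv a01 mid _ last a2 /=; split=> //.
by split; [apply: reduction_sound | apply: reduction_complete].
Qed.
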